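(* The system $\{\varphi_n\}_n$ is complete in $L^2(0,1)$ if one of the following conditions is fulfilled: (a) $S\varphi$ and $1/S\varphi$ are both in $\mathcal{H}_d$; (b) $S\varphi\in\mathcal{M}$ and $1/S\varphi\in\mathcal{H}$; (c) $S\varphi\in\mathcal{H}$ and $1/S\varphi\in\mathcal{M}$.
   Context: $\varphi\in L^2(0,1)$ is given, extended to the real line as an odd periodic function of period 2, with sine expansion $\varphi(x)=\sum_{n=1}^\infty a_n\sqrt2\sin(n\pi x)$ on $(0,1)$, normalized by $a_1=1$; $\varphi_n(x)=\varphi(nx)$ for $n=1,2,3,\ldots$, and $S\varphi(s)=\sum_{n=1}^\infty a_n n^{-s}$. The reciprocal is $1/S\varphi(s)=\sum_n b_n n^{-s}$, where $b_1=1$ and $\sum_{d\mid n}b_d a_{n/d}=0$ for $n>1$; this series converges absolutely in some right half-plane. A system is complete if its linear span is dense. $\mathcal{H}$ is the Hilbert space of Dirichlet series $f(s)=\sum_{n=1}^\infty c_n n^{-s}$ with $\sum_n|c_n|^2<+\infty$ (norm $\|f\|_{\mathcal{H}}=(\sum_n|c_n|^2)^{1/2}$), regarded as analytic functions on $\Re s>\frac12$. $\mathcal{M}$ is the set of multipliers of $\mathcal{H}$: holomorphic $m$ on $\Re s>\frac12$ with $mf\in\mathcal{H}$ for all $f\in\mathcal{H}$. $\mathcal{H}_d$ is the collection of Dirichlet series $\sum_n c_n n^{-s}$ with $\sum_{n=1}^\infty|c_n|^2d(n)<+\infty$, where $d(n)$ is the number of positive divisors of $n$. *)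

(* Defs.v *)
From HB Require Import structures.
From mathcomp Require Import all_boot all_order all_algebra.
From mathcomp Require Import complex.
From mathcomp Require Import all_classical all_reals all_analysis.

Set Implicit Arguments.
Unset Strict Implicit.
Unset Printing Implicit Defensive.

Import Order.TTheory GRing.Theory Num.Theory.
Import numFieldNormedType.Exports.

Local Open Scope classical_set_scope.
Local Open Scope complex_scope.
Local Open Scope ring_scope.

(* Complex numbers are R[i]; the alias (R[i])^o is used where its topology or
   its structure of normed module over itself is needed. Functions on (0,1) are
   represented by functions on R. Sequences are indexed by nat, but only the
   indices n >= 1 are ever used. *)

Section L2.
Context {R : realType}.
Implicit Types (f g : R -> R[i]) (n : nat).

Local Notation mu := (@lebesgue_measure R).
Local Notation I01 := (`]0%R, 1%R[%classic : set R).

Definition L2_norm f : \bar R :=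
  ((\int[mu]_(x in I01) ((Normc.normc (f x) ^+ 2)%:E)) `^ (2^-1))%E.

Definition in_L2 f : Prop :=
  [/\ measurable_fun I01 (fun x => complex.Re (f x)),
      measurable_fun I01 (fun x => complex.Im (f x)) &
      (L2_norm f < +oo)%E].

(* The coefficient of f with respect to the orthonormal basis
   (sqrt 2 * sin (n pi x))_(n >= 1) of L^2(0,1); the integral of a
   complex-valued function is taken componentwise. *)
Definition sine_coef f n : R[i] :=
  let e x := Num.sqrt 2 * sin (n%:R * pi * x) in
  (\int[mu]_(x in I01) (complex.Re (f x) * e x)) +i*
  (\int[mu]_(x in I01) (complex.Im (f x) * e x)).

Definition dilate f n : R -> R[i] := fun x => f (n%:R * x).

Definition complete_system (e : nat -> R -> R[i]) : Prop :=
  forall g, in_L2 g -> forall eps : R, 0 < eps ->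
  exists (N : nat) (c : nat -> R[i]),
    (L2_norm (fun x => g x - \sum_(1 <= n < N.+1) c n * e n x)%R < eps%:E)%E.

End L2.

Section DirichletSeries.
Context {R : realType}.
Implicit Types (c : nat -> R[i]) (f m : R[i] -> R[i]) (s : R[i]).

(* n^{-s}, for n >= 1 *)
Definition npow_opp (n : nat) s : R[i] :=
  (expR (- (complex.Re s * ln (n%:R : R))))%:C *
  (cos (complex.Im s * ln (n%:R : R)) -i* sin (complex.Im s * ln (n%:R : R))).

(* The series of the c n * n^{-s} over n >= 1 converges, with sum l. *)
Definition dirichlet_sum c s (l : R[i]) : Prop :=
  (fun N : nat => \sum_(1 <= n < N.+1) c n * npow_opp n s : (R[i])^o) @ \oo
    --> (l : (R[i])^o).

Definition is_reciprocal (a b : nat -> R[i]) : Prop :=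
  b 1%N = 1 /\
  forall n : nat, (1 < n)%N -> \sum_(d <- divisors n) b d * a (n %/ d)%N = 0.

(* Membership of a Dirichlet series, given by its coefficients, in the
   Hilbert space H. *)
Definition series_in_H c : Prop :=
  (\sum_(1 <= n <oo) (Normc.normc (c n) ^+ 2)%:E < +oo)%E.

Definition series_in_Hd c : Prop :=
  (\sum_(1 <= n <oo)
     (Normc.normc (c n) ^+ 2 * (size (divisors n))%:R)%:E < +oo)%E.

(* The values of f outside the half-plane Re s > 1/2 are irrelevant in the
   next two definitions. *)
Definition in_H f : Prop :=
  exists2 c, series_in_H c &
    forall s, 2^-1 < complex.Re s -> dirichlet_sum c s (f s).

Definition multiplier m : Prop :=
  (forall s, 2^-1 < complex.Re s -> derivable (m : (R[i])^o -> (R[i])^o) s 1) /\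
  forall f, in_H f -> in_H (fun s => m s * f s).

(* A Dirichlet series may a priori converge only in a smaller half-plane
   Re s > sigma; it belongs to M when the function it defines there is (the
   restriction of) a multiplier. *)
Definition series_in_M c : Prop :=
  exists2 m, multiplier m &
    exists sigma : R, forall s, sigma < complex.Re s -> dirichlet_sum c s (m s).

End DirichletSeries.

(* Main.v *)
Require Import Defs.
From HB Require Import structures.
From mathcomp Require Import all_boot all_order all_algebra.
From mathcomp Require Import complex ring lra zify.
From mathcomp Require Import all_classical all_reals all_analysis.
From mathcomp Require Import measurable_realfun.

(** Expanding in the sine basis turns the dilate phi_n into n^(-s) Sphi(s), so
    the closed span of the dilates corresponds to the closure in l2 of the
    Dirichlet convolutions p * a with p finitely supported.  If delta1, the
    unit of convolution, lies in that closure, then the first sine is a limit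
    of combinations of dilates; dilating by k, which is isometric on odd
    functions of period 2, gives the k-th sine ([spanned_csine]); and the sines
    are complete ([sine_polys_dense]).

    It remains to approach delta1 = b * a ([l2_near_invertible]).
    - When a and b are in Hd, the truncations of b do it, because
      |u * v| <= |u|_d |v|_d for the norms weighted by the divisor function
      ([nsq_dconv_weighted]).
    - When a is a multiplier, convolution by a maps l2 to l2.  It is then
      bounded: otherwise perturbations supported further and further away
      would build some c in l2 with a * c outside l2 ([dconv_uniform_bound]).
      So a * p tends to a * b when p is a truncation of b.
    - When b is a multiplier, truncations of b need not be uniformly bounded as
      operators, but Fejer means are.  The kernel is
      w(n) = #{d | L : n d | L} / #{d | L}.  It is positive definite on ratios,
      so that b |-> w b does not increase the norm of the convolution operator
      ([dconv_bounded_fejer]); it is finitely supported; and it tends to 1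
      along L = (M!)^r for suitable r, because the number of divisors of (M!)^r
      grows polynomially in r ([fejer_weight_near1]).  Hence (w b) * x tends to b * x for finitely
      supported x, and by uniform boundedness also for x = a.

    The passage from multipliers, which are functions on a half-plane, to
    convolution of coefficients uses asymptotic expansions in the n^(-s) as
    s -> +oo along the reals: they determine the coefficients and multiply by
    convolution ([dirichlet_asymp_unique], [dirichlet_asympM]).

    The sines are complete because combinations of sines are stable under
    multiplication by cos (pi x), and the polynomials (1 - y^n)^(2^n) turn a
    polynomial y in cos (pi x) into the indicator of the set where y < 1/2.
    This reaches sin (pi x) times the indicator of a half-line, then of a Borel
    set by a monotone class argument, then any square integrable function. *)

Set Implicit Arguments.
Unset Strict Implicit.
Unset Printing Implicit Defensive.

Import Order.TTheory GRing.Theory Num.Theory.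
Import numFieldNormedType.Exports.

Local Open Scope complex_scope.
Local Open Scope ring_scope.

(** * Squared moduli and Dirichlet convolution *)

Section SquaredModulus.
Context {R : rcfType}.
Implicit Types z w : R[i].

Definition sqn z : R := Normc.normc z ^+ 2.

Lemma sqnE z : sqn z = complex.Re z ^+ 2 + complex.Im z ^+ 2.
Proof. by case: z => x y; rewrite /sqn /= sqr_sqrtr // addr_ge0 ?sqr_ge0. Qed.

Lemma sqn_ge0 z : 0 <= sqn z. Proof. exact: sqr_ge0. Qed.

Lemma normc_ge0 z : 0 <= Normc.normc z.
Proof. by case: z => x y; exact: sqrtr_ge0. Qed.

Lemma sqn0 : sqn 0 = 0. Proof. by rewrite sqnE /= expr0n addr0. Qed.

Lemma sqn1 : sqn 1 = 1. Proof. by rewrite sqnE /= expr1n expr0n addr0. Qed.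

Lemma sqnM z w : sqn (z * w) = sqn z * sqn w.
Proof. by rewrite /sqn Normc.normcM exprMn. Qed.

Lemma sqnN z : sqn (- z) = sqn z.
Proof. by case: z => x y; rewrite !sqnE /= !sqrrN. Qed.

Lemma sqnD_le z w : sqn (z + w) <= 2 * sqn z + 2 * sqn w.
Proof.
case: z w => x y [x' y']; rewrite !sqnE /=.
have := sqr_ge0 (x - x'); have := sqr_ge0 (y - y'); nra.
Qed.

Lemma sqn_real (x : R) : sqn x%:C = x ^+ 2.
Proof. by rewrite sqnE /= expr0n addr0. Qed.

Lemma sqn_eq0 z : sqn z = 0 -> z = 0.
Proof. by move=> /eqP; rewrite sqrf_eq0 => /eqP/Normc.eq0_normc. Qed.

Lemma sqn_sum_mul (I : Type) (r : seq I) (P : pred I) (x y : I -> R[i]) :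
  sqn (\sum_(i <- r | P i) x i * y i) <=
  (\sum_(i <- r | P i) sqn (x i)) * (\sum_(i <- r | P i) sqn (y i)).
Proof.
elim: r => [|i r IH]; first by rewrite !big_nil sqn0 mul0r.
rewrite !big_cons; case: ifP => // _.
set s := \sum_(_ <- r | _) _ * _ in IH *.
set A := \sum_(_ <- r | _) _ in IH *; set B := \sum_(_ <- r | _) _ in IH *.
have A0 : 0 <= A by apply: sumr_ge0 => *; exact: sqn_ge0.
have B0 : 0 <= B by apply: sumr_ge0 => *; exact: sqn_ge0.
rewrite /sqn in IH *.
set S := Normc.normc s in IH *.
have S0 : 0 <= S by exact: normc_ge0.
set u := Normc.normc (x i); set v := Normc.normc (y i).
have u0 : 0 <= u by exact: normc_ge0.
have v0 : 0 <= v by exact: normc_ge0.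
have le1 : Normc.normc (x i * y i + s) <= u * v + S.
  by rewrite (le_trans (le_normcD _ _)) // Normc.normcM.
have le2 : 2 * S * u * v <= A * v ^+ 2 + B * u ^+ 2.
  rewrite -(@ler_pXn2r _ 2) ?nnegrE //; last 2 first.
  - by rewrite !mulr_ge0.
  - by rewrite addr_ge0 // mulr_ge0 ?sqr_ge0.
  have := sqr_ge0 (A * v ^+ 2 - B * u ^+ 2).
  have : S ^+ 2 * (u * v) ^+ 2 <= A * B * (u * v) ^+ 2.
    by rewrite ler_wpM2r ?sqr_ge0.
  nra.
apply: (@le_trans _ _ ((u * v + S) ^+ 2)).
  by rewrite ler_pXn2r ?nnegrE ?normc_ge0 // addr_ge0 ?mulr_ge0.
nra.
Qed.

Lemma sqn_sum_le (I : Type) (r : seq I) (x : I -> R[i]) :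
  sqn (\sum_(i <- r) x i) <= (size r)%:R * \sum_(i <- r) sqn (x i).
Proof.
have := sqn_sum_mul r predT (fun=> 1) x.
rewrite (eq_bigr x) => [|i _]; last by rewrite mul1r.
move=> /le_trans; apply; rewrite ler_wpM2r //.
  by apply: sumr_ge0 => *; exact: sqn_ge0.
by rewrite (eq_bigr (fun=> 1)) ?big_const_seq ?count_predT ?iter_addr_0 // => *; rewrite sqn1.
Qed.

End SquaredModulus.

Lemma sum_divisors (F : nmodType) (n N : nat) (G : nat -> F) : (0 < n)%N ->
  (forall j, (N < j)%N -> (j %| n)%N -> G j = 0) ->
  \sum_(d <- divisors n) G d = \sum_(1 <= j < N.+1 | (j %| n)%N) G j.
Proof.
move=> n0 G0.
have E : forall M, (n <= M)%N ->
    \sum_(d <- divisors n) G d = \sum_(1 <= j < M.+1 | (j %| n)%N) G j.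
  move=> M nM; rewrite -[RHS]big_filter; apply: perm_big; apply: uniq_perm.
  - exact: divisors_uniq.
  - by rewrite filter_uniq // iota_uniq.
  move=> d; rewrite mem_filter mem_index_iota -dvdn_divisors //.
  case: (boolP (d %| n)%N) => //= dn.
  by rewrite (dvdn_gt0 n0 dn) ltnS (leq_trans (dvdn_leq n0 dn)).
rewrite (E (maxn n N)) ?leq_maxl //.
rewrite (@big_cat_nat _ _ _ N.+1) //= ?ltnS ?leq_maxr //.
rewrite [X in _ + X]big1_seq ?addr0 // => j /andP[jn].
by rewrite mem_index_iota => /andP[Nj _]; exact: G0.
Qed.

Lemma sum_multiples (F : nmodType) (j N : nat) (G : nat -> F) : (0 < j)%N ->
  \sum_(1 <= n < N.+1 | (j %| n)%N) G n =
  \sum_(1 <= k < (N %/ j).+1) G (j * k)%N.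
Proof.
move=> j0; rewrite -(big_map (muln j) xpredT G) -[LHS]big_filter.
apply: perm_big; apply: uniq_perm.
- by rewrite filter_uniq // iota_uniq.
- rewrite map_inj_uniq ?iota_uniq // => x y /eqP.
  by rewrite eqn_pmul2l // => /eqP.
move=> n; rewrite mem_filter mem_index_iota; apply/idP/mapP.
  move=> /and3P[/dvdnP[k ->] n1 nN]; exists k; last by rewrite mulnC.
  move: n1 nN; rewrite muln_gt0 mem_index_iota !ltnS leq_divRL //.
  by move=> /andP[-> _].
move=> [k]; rewrite mem_index_iota ltnS leq_divRL // => /andP[k0 kN] ->.
by rewrite dvdn_mulr //= muln_gt0 j0 k0 ltnS mulnC.
Qed.

Section DirichletConvolution.
Context {F : comNzRingType}.
Implicit Types u v w : nat -> F.

Definition dconv u v (n : nat) : F := \sum_(d <- divisors n) u d * v (n %/ d)%N.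

Definition delta1 (n : nat) : F := (n == 1%N)%:R.

Definition trunc (N : nat) u (n : nat) : F := if (n <= N)%N then u n else 0.

Lemma dconvE u v (n : nat) : (0 < n)%N ->
  dconv u v n = \sum_(1 <= j < n.+1 | (j %| n)%N) u j * v (n %/ j)%N.
Proof.
by move=> n0; apply: sum_divisors => // j nj /(dvdn_leq n0); rewrite leqNgt nj.
Qed.

Lemma dconvC u v (n : nat) : (0 < n)%N -> dconv u v n = dconv v u n.
Proof.
move=> n0; have K d : (d %| n)%N -> (n %/ (n %/ d) = d)%N.
  by move=> dn; rewrite divnA // mulKn.
rewrite /dconv.
have -> : \sum_(d <- divisors n) v d * u (n %/ d)%N =
    \sum_(d <- divisors n) u (n %/ d)%N * v (n %/ (n %/ d))%N.
  by apply: eq_big_seq => d; rewrite -dvdn_divisors // => dn; rewrite mulrC K.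
rewrite -(big_map (fun d => n %/ d)%N xpredT (fun d => u d * v (n %/ d)%N)).
apply: perm_big; apply: uniq_perm; first exact: divisors_uniq.
  rewrite map_inj_in_uniq ?divisors_uniq // => x y.
  by rewrite -!dvdn_divisors // => xn yn E; rewrite -(K x xn) E K.
move=> d; rewrite -dvdn_divisors //; apply/idP/mapP.
  move=> dn; exists (n %/ d)%N; last by rewrite K.
  by rewrite -dvdn_divisors // dvdn_div.
by move=> [e]; rewrite -dvdn_divisors // => en ->; rewrite dvdn_div.
Qed.

Lemma eq_dconv u u' v v' (n : nat) : (0 < n)%N ->
  (forall k, (0 < k <= n)%N -> u k = u' k) ->
  (forall k, (0 < k <= n)%N -> v k = v' k) -> dconv u v n = dconv u' v' n.
Proof.
move=> n0 Eu Ev; rewrite /dconv; apply: eq_big_seq => d.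
rewrite -dvdn_divisors // => dn.
have d0 := dvdn_gt0 n0 dn; have dn' := dvdn_leq n0 dn.
rewrite (Eu d) ?d0 // (Ev (n %/ d)%N) //.
by rewrite divn_gt0 // dn' leq_div.
Qed.

Lemma dconvBl u v w (n : nat) : dconv (fun k => u k - v k) w n = dconv u w n - dconv v w n.
Proof. by rewrite /dconv -sumrB; apply: eq_bigr => d _; rewrite mulrBl. Qed.

Lemma dconvDr u v w (n : nat) : dconv u (fun k => v k + w k) n = dconv u v n + dconv u w n.
Proof. by rewrite /dconv -big_split; apply: eq_bigr => d _; rewrite mulrDr. Qed.

Lemma dconvBr u v w (n : nat) : dconv u (fun k => v k - w k) n = dconv u v n - dconv u w n.
Proof. by rewrite /dconv -sumrB; apply: eq_bigr => d _; rewrite mulrBr. Qed.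

Lemma dconvZr u v (c : F) (n : nat) : dconv u (fun k => c * v k) n = c * dconv u v n.
Proof. by rewrite /dconv mulr_sumr; apply: eq_bigr => d _; rewrite mulrCA. Qed.

End DirichletConvolution.

(** The product of two Dirichlet polynomials, term by term; E n stands for the
    basis vector of index n. *)
Lemma sum_dconv_supp (F : comNzRingType) (p u E : nat -> F) (M L T : nat) :
  (forall n, (M < n)%N -> p n = 0) -> (forall n, (L < n)%N -> u n = 0) ->
  (M * L <= T)%N -> (M <= T)%N ->
  \sum_(1 <= m < T.+1) dconv p u m * E m =
  \sum_(1 <= n < M.+1) \sum_(1 <= l < L.+1) p n * u l * E (n * l)%N.
Proof.
move=> p0 u0 MLT MT.
rewrite (eq_big_nat _ _ (F2 := fun m => \sum_(1 <= n < M.+1 | (n %| m)%N)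
    p n * u (m %/ n)%N * E m)); last first.
  move=> m /andP[m0 _]; rewrite /dconv (@sum_divisors _ m M) // ?mulr_suml //.
  by move=> j /p0 -> _; rewrite mul0r.
rewrite (exchange_big_dep xpredT) //=; apply: eq_big_nat => n /andP[n0 nM].
rewrite sum_multiples //.
have LT : (L <= T %/ n)%N.
  by rewrite leq_divRL // (leq_trans _ MLT) // mulnC leq_mul2r -ltnS nM orbT.
rewrite (@big_cat_nat _ _ _ L.+1) //= [X in _ + X]big_nat_cond [X in _ + X]big1 ?addr0.
  by apply: eq_bigr => l _; rewrite mulKn.
by move=> l /andP[/andP[Ll _] _]; rewrite mulKn // u0 // mulr0 mul0r.
Qed.

(** * Square sums of Dirichlet convolutions *)

(** Every divisor of m n is the product of a divisor of m, namely its gcd with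
    m, and a divisor of n. *)
Lemma leq_divisorsM (m n : nat) : (0 < m)%N -> (0 < n)%N ->
  (size (divisors (m * n)) <= size (divisors m) * size (divisors n))%N.
Proof.
move=> m0 n0.
rewrite -(size_allpairs muln); apply: uniq_leq_size; first exact: divisors_uniq.
move=> d; rewrite -dvdn_divisors ?muln_gt0 ?m0 // => dmn.
have d0 : (0 < d)%N by apply: (dvdn_gt0 _ dmn); rewrite muln_gt0 m0.
apply/allpairsP; exists (gcdn d m, d %/ gcdn d m)%N; rewrite /= -!dvdn_divisors //.
rewrite dvdn_gcdr; split => //; last by rewrite mulnC divnK // dvdn_gcdl.
have g0 : (0 < gcdn d m)%N by rewrite gcdn_gt0 d0.
rewrite -(@Gauss_dvdr _ (m %/ gcdn d m)).
  rewrite -(@dvdn_pmul2l (gcdn d m)) // mulnA.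
  by rewrite [(gcdn d m * (d %/ _))%N]mulnC [(gcdn d m * (m %/ _))%N]mulnC !divnK ?dvdn_gcdl ?dvdn_gcdr.
by rewrite /coprime -(eqn_pmul2l g0) muln_gcdr muln1 ![(gcdn d m * (_ %/ _))%N]mulnC
  !divnK ?dvdn_gcdl ?dvdn_gcdr.
Qed.

Section RealSums.
Context {R : realType}.
Implicit Types g h : nat -> R.

Lemma ler_sum_nat_wide (m N N' : nat) g : (forall n, 0 <= g n) -> (N <= N')%N ->
  \sum_(m <= n < N) g n <= \sum_(m <= n < N') g n.
Proof.
move=> g0 NN'; have [mN|Nm] := leqP m N; last by rewrite big_geq ?sumr_ge0 // ltnW.
by rewrite (big_cat_nat mN NN') lerDl sumr_ge0.
Qed.

Lemma ler_sum_multiples (j N : nat) g : (0 < j)%N -> (forall n, 0 <= g n) ->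
  \sum_(1 <= n < N.+1 | (j %| n)%N) g (n %/ j)%N <= \sum_(1 <= n < N.+1) g n.
Proof.
move=> j0 g0; rewrite sum_multiples //.
under eq_bigr do rewrite mulKn //.
by apply: ler_sum_nat_wide => //; rewrite ltnS leq_div.
Qed.

Lemma ler_sum_dconv (N : nat) g h : (forall n, 0 <= g n) -> (forall n, 0 <= h n) ->
  \sum_(1 <= n < N.+1) dconv g h n <=
  (\sum_(1 <= n < N.+1) g n) * (\sum_(1 <= n < N.+1) h n).
Proof.
move=> g0 h0.
have -> : \sum_(1 <= n < N.+1) dconv g h n =
   \sum_(1 <= n < N.+1) \sum_(1 <= j < N.+1 | (j %| n)%N) g j * h (n %/ j)%N.
  rewrite big_nat [RHS]big_nat; apply: eq_bigr => n /andP[n0 nN].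
  apply: sum_divisors => // j Nj /(dvdn_leq n0) jn; lia.
rewrite (exchange_big_dep xpredT) //= mulr_suml.
rewrite big_nat [leRHS]big_nat; apply: ler_sum => j /andP[j0 _].
rewrite -mulr_sumr ler_wpM2l //; exact: ler_sum_multiples.
Qed.

Lemma bounded_sum_tail g (K e : R) : (forall n, 0 <= g n) ->
  (forall N, \sum_(1 <= n < N.+1) g n <= K) -> 0 < e ->
  exists M, forall N, \sum_(1 <= n < N.+1) (if (n <= M)%N then 0 else g n) <= e.
Proof.
move=> g0 gK e0; pose A := [set \sum_(1 <= n < N.+1) g n | N in setT]%classic.
have supA : has_sup A.
  split; first by exists (\sum_(1 <= n < 1) g n); exists 0%N.
  by exists K => _ [N _ <-].
have [_ [M _ <-] HM] := sup_adherent e0 supA.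
exists M => N; have [NM|MN] := leqP N M.
  rewrite big_nat_cond big1 ?ltW // => n /andP[/andP[_ nN] _].
  by rewrite (leq_trans _ NM).
have : \sum_(1 <= n < N.+1) g n <= sup A by apply: ub_le_sup; [case: supA|exists N].
rewrite !(@big_cat_nat _ _ _ M.+1 1 N.+1) //= ?ltnS ?(ltnW MN) //.
have -> : \sum_(1 <= n < M.+1) (if (n <= M)%N then 0 else g n) = 0.
  by rewrite big_nat big1 // => n /andP[_]; rewrite ltnS => ->.
have -> : \sum_(M.+1 <= n < N.+1) (if (n <= M)%N then 0 else g n) =
    \sum_(M.+1 <= n < N.+1) g n.
  by rewrite big_nat [RHS]big_nat; apply: eq_bigr => n /andP[nM _]; rewrite leqNgt nM.
move: HM; lra.
Qed.

End RealSums.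

Section SquareSums.
Context {R : realType}.
Implicit Types (u v x c : nat -> R[i]) (N M : nat).

(** Everything on the side of the coefficients is done with these real partial
    sums; l2 is then a uniform bound on them. *)
Definition nsq N c : R := \sum_(1 <= n < N.+1) sqn (c n).

Definition l2 c := exists K : R, forall N, nsq N c <= K.

Lemma nsq_ge0 N c : 0 <= nsq N c.
Proof. by apply: sumr_ge0 => *; exact: sqn_ge0. Qed.

Lemma nsq_mono N M c : (N <= M)%N -> nsq N c <= nsq M c.
Proof. by move=> NM; apply: ler_sum_nat_wide => // n; exact: sqn_ge0. Qed.

Lemma eq_nsq N u v : (forall n, (0 < n <= N)%N -> u n = v n) -> nsq N u = nsq N v.
Proof. by move=> E; rewrite /nsq big_nat [RHS]big_nat; apply: eq_bigr => n nN; rewrite E. Qed.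

Lemma nsqD_le N u v : nsq N (fun n => u n + v n) <= 2 * nsq N u + 2 * nsq N v.
Proof.
rewrite /nsq !mulr_sumr -big_split; apply: ler_sum => n _; exact: sqnD_le.
Qed.

Lemma nsqN N u : nsq N (fun n => - u n) = nsq N u.
Proof. by apply: eq_bigr => n _; rewrite sqnN. Qed.

Lemma nsqB_le N u v : nsq N (fun n => u n - v n) <= 2 * nsq N u + 2 * nsq N v.
Proof. by rewrite -(nsqN N v) nsqD_le. Qed.

Lemma nsqZ N (z : R[i]) u : nsq N (fun n => z * u n) = sqn z * nsq N u.
Proof. by rewrite /nsq mulr_sumr; apply: eq_bigr => n _; rewrite sqnM. Qed.

Lemma nsq_supp N M u : (forall n, (M < n)%N -> u n = 0) -> nsq N u <= nsq M u.
Proof.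
move=> u0; have [NM|MN] := leqP N M; first exact: nsq_mono.
rewrite /nsq (@big_cat_nat _ _ _ M.+1) //=; last by rewrite ltnS ltnW.
rewrite [X in _ + X]big_nat_cond [X in _ + X]big1 ?addr0 // => n /andP[/andP[Mn _] _].
by rewrite u0 ?sqn0.
Qed.

Lemma l2_tail c (e : R) : l2 c -> 0 < e ->
  exists M, forall N, nsq N (fun n => c n - trunc M c n) <= e.
Proof.
move=> [K cK] e0.
have [M HM] := bounded_sum_tail (fun n => sqn_ge0 (c n)) cK e0.
exists M => N; apply: le_trans (HM N); rewrite le_eqVlt; apply/orP; left; apply/eqP.
by apply: eq_bigr => n _; rewrite /trunc; case: ifP; rewrite ?subrr ?subr0 ?sqn0.
Qed.

(** The Cauchy-Schwarz inequality over the divisors of n costs a factor d(n),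
    which is at most d(k) d(n/k) for each divisor k. *)
Lemma nsq_dconv_weighted N u v :
  nsq N (dconv u v) <=
  (\sum_(1 <= n < N.+1) sqn (u n) * (size (divisors n))%:R) *
  (\sum_(1 <= n < N.+1) sqn (v n) * (size (divisors n))%:R).
Proof.
apply: le_trans (ler_sum_dconv N _ _); last 2 first.
- by move=> n; rewrite mulr_ge0 ?sqn_ge0.
- by move=> n; rewrite mulr_ge0 ?sqn_ge0.
rewrite /nsq big_nat [leRHS]big_nat; apply: ler_sum => n /andP[n0 _].
rewrite /dconv (le_trans (sqn_sum_le _ _)) // mulr_sumr.
rewrite big_seq [leRHS]big_seq; apply: ler_sum => d; rewrite -dvdn_divisors // => dn.
rewrite sqnM; set s := sqn _; set t := sqn _.
have -> : forall p q : R, s * p * (t * q) = p * q * (s * t) by move=> p q; ring.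
apply: ler_wpM2r; first by rewrite mulr_ge0 ?sqn_ge0.
rewrite -natrM ler_nat -{1}(divnK dn) mulnC.
by rewrite leq_divisorsM ?divn_gt0 ?(dvdn_gt0 n0 dn) // dvdn_leq.
Qed.

(** Convolution by a unit vector does not increase the norm; the factor M is
    the Cauchy-Schwarz price for adding M of them. *)
Lemma nsq_dconv_supp N M u x : (forall n, (M < n)%N -> x n = 0) ->
  nsq N (dconv u x) <= M%:R * nsq M x * nsq N u.
Proof.
move=> x0.
have H n : (0 < n <= N)%N -> sqn (dconv u x n) <=
    nsq M x * \sum_(1 <= j < M.+1 | (j %| n)%N) sqn (u (n %/ j)%N).
  move=> /andP[n0 nN]; rewrite dconvC // /dconv (@sum_divisors _ n M) //; last first.
    by move=> j /x0 -> _; rewrite mul0r.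
  apply: (le_trans (sqn_sum_mul _ _ _ _)); rewrite ler_wpM2r //.
    by apply: sumr_ge0 => *; exact: sqn_ge0.
  rewrite /nsq [leRHS](bigID (fun j => j %| n)%N) /= lerDl.
  by apply: sumr_ge0 => *; exact: sqn_ge0.
apply: (@le_trans _ _ (\sum_(1 <= n < N.+1)
    nsq M x * \sum_(1 <= j < M.+1 | (j %| n)%N) sqn (u (n %/ j)%N))).
  by rewrite /nsq big_nat [leRHS]big_nat; apply: ler_sum => n; exact: H.
rewrite -mulr_sumr [M%:R * _]mulrC -mulrA ler_wpM2l ?nsq_ge0 //.
rewrite (exchange_big_dep xpredT) //=.
have -> : M%:R * nsq N u = \sum_(1 <= j < M.+1) nsq N u.
  by rewrite sumr_const_nat subn1 /= mulr_natl.
rewrite big_nat [leRHS]big_nat; apply: ler_sum => j /andP[j0 _].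
by apply: ler_sum_multiples => // n; exact: sqn_ge0.
Qed.

End SquareSums.

(** * Uniform boundedness of convolution operators *)

Section GlidingHump.
Context {R : realType}.
Implicit Types (a b c d : nat -> R[i]) (N M : nat) (K : R).

Definition dconv_bounded K a : Prop :=
  forall N c, nsq N (dconv a c) <= K * nsq N c.

(** The convolution of c with the unit vector of index q. *)
Definition spread (q : nat) c (n : nat) : R[i] :=
  if (q %| n)%N then c (n %/ q)%N else 0.

Lemma dconv_spread (q : nat) a c (n : nat) : (0 < q)%N -> (0 < n)%N ->
  dconv a (spread q c) n = spread q (dconv a c) n.
Proof.
move=> q0 n0; rewrite dconvC // dconvE // /spread; case: ifPn => [qn|qn].
  move: n0; rewrite -(divnK qn) mulnC; set m := (n %/ q)%N.
  rewrite muln_gt0 q0 /= => m0.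
  rewrite big_mkcond (eq_bigr (fun j => if (q %| j)%N then
     (if (j %| q * m)%N then c (j %/ q)%N * a (q * m %/ j)%N else 0) else 0)); last first.
    by move=> j _; case: ifP => // _; case: ifP => // _; rewrite mul0r.
  rewrite -big_mkcond sum_multiples // !mulKn //.
  rewrite (eq_bigr (fun k => if (k %| m)%N then c k * a (m %/ k)%N else 0)); last first.
    by move=> k _; rewrite dvdn_pmul2l // mulKn // divnMl.
  by rewrite -big_mkcond /= [RHS]dconvC // dconvE.
rewrite big1 // => j jn; case: ifP => qj; last by rewrite mul0r.
by move: qn; rewrite (dvdn_trans qj jn).
Qed.

Lemma nsq_spread (q N : nat) c : (0 < q)%N -> nsq (q * N) (spread q c) = nsq N c.
Proof.
move=> q0; rewrite {1}/nsq (eq_bigr (fun n => if (q %| n)%N then sqn (c (n %/ q)%N) else 0)).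
  rewrite -big_mkcond sum_multiples // mulKn //.
  by apply: eq_bigr => k _; rewrite mulKn.
by move=> n _; rewrite /spread; case: ifP; rewrite ?sqn0.
Qed.

Lemma l2_dconv_finite a N d :
  (forall c, l2 c -> l2 (dconv a c)) -> (forall n, (N < n)%N -> d n = 0) ->
  exists2 U : R, 0 <= U & forall M, nsq M (dconv a d) <= U.
Proof.
move=> aP d0; have [|U HU] := aP d; last first.
  by exists U => //; apply: le_trans (HU 0%N); exact: nsq_ge0.
by exists (nsq N d) => M; exact: nsq_supp.
Qed.

(** One hump: a finite sequence d is perturbed, by little and far away, so that
    a * d becomes as large as desired on an initial segment.  The perturbation
    is a violation of boundedness, rescaled to square norm e and moved to the
    multiples of q = N0 + 1, away from the support of d. *)
Lemma hump_step a d N0 (e K : R) :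
  (forall c, l2 c -> l2 (dconv a c)) -> (forall K', ~ dconv_bounded K' a) ->
  (forall n, (N0 < n)%N -> d n = 0) -> 0 < e ->
  exists p : (nat -> R[i]) * nat,
    [/\ (N0 < p.2)%N, forall n, (p.2 < n)%N -> p.1 n = 0,
        forall n, (0 < n <= N0)%N -> p.1 n = d n,
        nsq p.2 p.1 <= nsq N0 d + e & K <= nsq p.2 (dconv a p.1)].
Proof.
move=> aP aU d0 e0.
have [U U0 HU] := l2_dconv_finite aP d0.
(* the new part of a * p.1 has square norm at least K' e, of which the old part
   can cancel no more than U *)
pose K' := 2 * (`|K| + U) / e.
have : exists N, exists c, K' * nsq N c < nsq N (dconv a c).
  apply: contrapT => H; apply: (aU K') => N c; rewrite leNgt; apply/negP => Hc.
  by apply: H; exists N, c.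
move=> [N [c0 Hc0]].
have c0_gt0 : 0 < nsq N c0.
  rewrite lt_neqAle nsq_ge0 andbT; apply/eqP => /esym E.
  move: Hc0; rewrite E mulr0 ltNge => /negP; apply.
  rewrite /nsq big_nat big1 // => n /andP[n0 nN].
  rewrite (@eq_dconv _ a a c0 (fun=> 0)) //.
    by rewrite /dconv big1 ?sqn0 // => *; rewrite mulr0.
  move=> k /andP[k0 kn]; apply: sqn_eq0.
  have : sqn (c0 k) <= nsq N c0.
    rewrite /nsq (bigD1_seq k) ?iota_uniq ?mem_index_iota ?k0 ?(leq_ltn_trans kn) //=.
    by rewrite lerDl sumr_ge0 // => *; exact: sqn_ge0.
  by rewrite E => le0; apply/eqP; rewrite eq_le le0 sqn_ge0.
pose z : R[i] := (Num.sqrt (e / nsq N c0))%:C.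
have sqz : sqn z = e / nsq N c0.
  by rewrite sqn_real sqr_sqrtr // divr_ge0 ?nsq_ge0 ?ltW.
pose c := trunc N (fun n => z * c0 n).
have Ec : nsq N c = e.
  rewrite (@eq_nsq _ _ _ (fun n => z * c0 n)); last by move=> n /andP[_ nN]; rewrite /c /trunc nN.
  by rewrite nsqZ sqz divfK ?gt_eqF.
have Eac : K' * e <= nsq N (dconv a c).
  rewrite (@eq_nsq _ _ _ (fun n => z * dconv a c0 n)).
    rewrite nsqZ sqz (_ : K' * e = e / nsq N c0 * (K' * nsq N c0)).
      by rewrite ler_wpM2l ?divr_ge0 ?ltW.
    by field; rewrite gt_eqF.
  move=> n /andP[n0 nN]; rewrite -dconvZr; apply: eq_dconv => // k /andP[_ kn].
  by rewrite /c /trunc (leq_trans kn nN).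
pose q := N0.+1; have q0 : (0 < q)%N by [].
have N_gt0 : (0 < N)%N.
  by case: N c0_gt0 {Hc0 sqz c Ec Eac z} => //; rewrite /nsq big_geq ?ltxx.
have supp n : (0 < n)%N -> sqn (d n + spread q c n) = sqn (d n) + sqn (spread q c n).
  move=> n0; have [nN|/d0 ->] := leqP n N0; last by rewrite sqn0 !add0r.
  rewrite /spread; case: ifPn => [/(dvdn_leq n0)|]; last by rewrite sqn0 !addr0.
  by rewrite leqNgt ltnS nN.
exists (fun n => d n + spread q c n, (q * N)%N); split => /=.
- by rewrite (leq_trans (ltnSn N0)) // leq_pmulr.
- move=> n qNn; rewrite d0 ?add0r; last first.
    by rewrite (leq_trans _ qNn) // ltnS (leq_trans (leqnSn N0)) // leq_pmulr.
  rewrite /spread; case: ifP => // qn; rewrite /c /trunc leqNgt.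
  by rewrite ltn_divRL // mulnC qNn.
- move=> n /andP[n0 nN]; rewrite /spread; case: ifPn => [/(dvdn_leq n0)|]; rewrite ?addr0 //.
  by rewrite leqNgt ltnS nN.
- have -> : nsq (q * N) (fun n => d n + spread q c n) =
    nsq (q * N) d + nsq (q * N) (spread q c).
    by rewrite /nsq -big_split; apply: eq_big_nat => n /andP[n0 _]; exact: supp.
  by rewrite nsq_spread // Ec lerD2r; exact: nsq_supp.
have : nsq (q * N) (spread q (dconv a c)) <=
    2 * nsq (q * N) (dconv a (fun n => d n + spread q c n)) + 2 * nsq (q * N) (dconv a d).
  rewrite -[leLHS](@eq_nsq _ _ (fun n => dconv a (fun n => d n + spread q c n) n - dconv a d n)).
    exact: nsqB_le.
  by move=> n /andP[n0 _]; rewrite dconvDr addrC addKr dconv_spread.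
rewrite nsq_spread //; have := HU (q * N)%N; move: Eac.
rewrite /K' divfK ?gt_eqF //; have := ler_norm K; lra.
Qed.

(** Uniform boundedness for convolution operators, by a gliding hump: were the
    finite sections unbounded, the successive perturbations of [hump_step]
    would converge to some c in l2 with a * c outside l2. *)
Lemma dconv_uniform_bound a :
  (forall c, l2 c -> l2 (dconv a c)) -> exists2 K, 0 <= K & dconv_bounded K a.
Proof.
move=> aP; apply: contrapT => H.
have aU K' : ~ dconv_bounded K' a.
  move=> HK; apply: H; exists `|K'| => // N c.
  by rewrite (le_trans (HK N c)) // ler_wpM2r ?nsq_ge0 ?ler_norm.
pose st0 := ((nat -> R[i]) * nat)%type.
pose P (x : nat * st0) (p : st0) := (forall n, (x.2.2 < n)%N -> x.2.1 n = 0) ->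
    [/\ (x.2.2 < p.2)%N, forall n, (p.2 < n)%N -> p.1 n = 0,
        forall n, (0 < n <= x.2.2)%N -> p.1 n = x.2.1 n,
        nsq p.2 p.1 <= nsq x.2.2 x.2.1 + 2^-1 ^+ x.1.+1 & x.1%:R <= nsq p.2 (dconv a p.1)].
have /choice[f fP] : forall x, exists p, P x p.
  move=> [k [d N0]]; have [d0|nd0] := pselect (forall n, (N0 < n)%N -> d n = 0).
    have e0 : (0 : R) < 2^-1 ^+ k.+1 by rewrite exprn_gt0.
    by have [p Hp] := hump_step k%:R aP aU d0 e0; exists p.
  by exists (d, N0) => /nd0.
pose st := fix st k : st0 := if k is k'.+1 then f (k', st k') else (fun=> 0, 0%N).
have supp k : forall n, ((st k).2 < n)%N -> (st k).1 n = 0.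
  by elim: k => [//|k IH] n; have [_ + _ _ _] := fP (k, st k) IH; apply.
have stP k := fP (k, st k) (supp k).
have Nk k : (k <= (st k).2)%N.
  by elim: k => // k IH; have [/= + _ _ _ _] := stP k; exact: leq_ltn_trans.
have stable k j n : (k <= j)%N -> (0 < n <= (st k).2)%N -> (st j).1 n = (st k).1 n.
  move=> kj nk; rewrite -(subnK kj); elim: (j - k)%N => // i IH.
  have [/= _ _ -> //] := stP (i + k)%N; case/andP: nk => -> /= nk.
  apply: (leq_trans nk); elim: i {IH} => // i IH.
  by have [/= /ltnW /(leq_trans IH)] := stP (i + k)%N.
pose c n := (st n).1 n.
have cE k n : (0 < n <= (st k).2)%N -> c n = (st k).1 n.
  move=> nk; have [kn|nk'] := leqP k n; first exact: stable.
  by rewrite /c -(stable n k n (ltnW nk')) // Nk; case/andP: nk => ->.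
have stn k : nsq (st k).2 (st k).1 <= 1 - 2^-1 ^+ k.
  elim: k => [|k IH]; first by rewrite expr0 subrr /nsq /= big_geq.
  have [/= _ _ _ + _] := stP k; move/le_trans; apply.
  by rewrite !exprS in IH *; move: IH; lra.
have /aP[K HK] : l2 c.
  exists 1 => N; apply: (le_trans (nsq_mono _ (Nk N))).
  rewrite (eq_nsq (cE N)) (le_trans (stn N)) // lerBlDr lerDl exprn_ge0 //.
have [/= _ _ _ _] := stP (Num.truncn `|K|).+1.
set M := (f _).2; rewrite -/(st _.+1).
rewrite (@eq_nsq _ _ _ (dconv a c)).
  move=> /le_trans/(_ (HK _)); apply/negP; rewrite -ltNge.
  by rewrite (le_lt_trans (ler_norm K)) // truncnS_gt.
move=> n /andP[n0 nM]; apply: eq_dconv => // i /andP[i0 iN].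
by rewrite (cE (Num.truncn `|K|).+2) // i0 (leq_trans iN).
Qed.

End GlidingHump.

(** * Fejer weights on the positive integers *)

Section FejerWeight.

(** A divisor of A^r is determined by its valuations at the primes p <= A, each
    at most A r; the point is that the bound is polynomial in r. *)
Lemma size_divisors_exp_le (A r : nat) : (0 < A)%N ->
  (size (divisors (A ^ r)) <= (A * r).+1 ^ A.+1)%N.
Proof.
move=> A0; have Ar0 : (0 < A ^ r)%N by rewrite expn_gt0 A0.
pose f (d : nat) : {ffun 'I_A.+1 -> 'I_(A * r).+1} := [ffun p => inord (logn (val p) d)].
have le_log p d : (d %| A ^ r)%N -> (logn p d <= A * r)%N.
  move=> dA; apply: (leq_trans (dvdn_leq_log p Ar0 dA)).
  by rewrite lognX mulnC leq_mul2r ltnW ?orbT // ltn_logl.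
rewrite -[leqRHS](_ : size (enum {ffun 'I_A.+1 -> 'I_(A * r).+1}) = _); last first.
  by rewrite -cardE card_ffun !card_ord.
rewrite -(size_map f); apply: uniq_leq_size; last by move=> g _; rewrite mem_enum.
rewrite map_inj_in_uniq ?divisors_uniq // => x y; rewrite -!dvdn_divisors // => xA yA E.
apply: eqn_from_log; rewrite ?(dvdn_gt0 Ar0) // => p.
have [pA|Ap] := leqP p A.
  have /ffunP/(_ (Ordinal (pA : (p < A.+1)%N))) := E.
  by rewrite !ffunE => /(congr1 val); rewrite /= !inordK ?ltnS ?le_log.
have lA : logn p A = 0%N.
  by rewrite lognE; case: ifP => // /and3P[_ _ /(dvdn_leq A0)]; rewrite leqNgt Ap.
have l0 d : (d %| A ^ r)%N -> logn p d = 0%N.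
  move=> dA; apply/eqP; rewrite -leqn0 (leq_trans (dvdn_leq_log p Ar0 dA)) //.
  by rewrite lognX lA muln0.
by rewrite !l0.
Qed.

Context {R : realType}.
Implicit Types (a b c x : nat -> R[i]) (N M L : nat) (K e : R).

(** With r = (B + 1) s, the Bernoulli inequality makes (1 + e)^r at least
    (s e)^(B + 1), one degree more in s than the left-hand side. *)
Lemma geometric_beats_polynomial (e : R) (A B : nat) : 0 < e ->
  exists r : nat, ((A * r).+1 ^ B)%:R < (1 + e) ^+ r.
Proof.
move=> e0.
pose D : R := ((A * B.+1).+1 ^ B)%:R.
pose s := (Num.truncn (D / e ^+ B.+1)).+1.
exists (B.+1 * s)%N.
have s1 : (1 <= s)%N by [].
have H1 : 1 + e *+ s <= (1 + e) ^+ s.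
  elim: s {s1} => [|s IH]; first by rewrite mulr0n addr0 expr0.
  rewrite exprS mulrS; have : 0 <= e *+ s by rewrite mulrn_wge0 ?ltW.
  nra.
have H2 : (s%:R * e) ^+ B.+1 < (1 + e) ^+ (B.+1 * s).
  rewrite mulnC exprM ltr_pXn2r ?nnegrE ?mulr_ge0 ?exprn_ge0 ?addr_ge0 ?ltW //.
  by apply: lt_le_trans H1; rewrite mulr_natl ltrDr.
apply: le_lt_trans H2; rewrite exprMn exprS.
have : D / e ^+ B.+1 <= s%:R by rewrite ltW // truncnS_gt.
rewrite ler_pdivrMr ?exprn_gt0 // => Ds.
apply: (@le_trans _ _ (D * s%:R ^+ B)).
  rewrite /D !natrX -exprMn lerXn2r ?nnegrE ?mulr_ge0 // -natrM ler_nat; nia.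
by rewrite mulrAC ler_wpM2r ?exprn_ge0.
Qed.

(** For the set F of divisors of L, this is |F meet n^(-1) F| / |F|, as in the
    classical Fejer kernel where F is an interval of integers. *)
Definition fejer_weight L (n : nat) : R :=
  (\sum_(d <- divisors L) ((n * d %| L)%N : nat))%:R / (size (divisors L))%:R.

Lemma divisors_neq0 L : (size (divisors L))%:R != 0 :> R.
Proof.
rewrite pnatr_eq0 size_eq0; case: (posnP L) => [-> //|L0].
by apply/eqP => E; have := dvdn_divisors 1 L0; rewrite dvd1n E.
Qed.

(** Weights tending to 1 exist because the divisors of (M!)^r form a Folner
    sequence for multiplication: their number grows polynomially in r, and
    multiplication by n <= M maps the divisors of (M!)^r into those of
    (M!)^(r+1). *)
Lemma fejer_weight_near1 M e : 0 < e ->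
  exists2 L, (0 < L)%N & forall n, (0 < n <= M)%N -> 1 - e <= fejer_weight L n <= 1.
Proof.
move=> e0; pose A := M`!; have A0 : (0 < A)%N := fact_gt0 M.
pose F r := divisors (A ^ r).
have Ar0 r : (0 < A ^ r)%N by rewrite expn_gt0 A0.
have [r Hr] : exists r, (size (F r.+1))%:R <= (1 + e) * (size (F r))%:R.
  apply: contrapT => H.
  have grow r : (1 + e) ^+ r <= (size (F r))%:R.
    elim: r => [|r IH]; first by rewrite expr0 ler1n lt0n -(pnatr_eq0 R) divisors_neq0.
    rewrite exprS.
    apply: (@le_trans _ _ ((1 + e) * (size (F r))%:R)).
      by rewrite ler_wpM2l // addr_ge0 // ltW.
    by rewrite leNgt; apply/negP => /ltW Hr; apply: H; exists r.
  have [r] := geometric_beats_polynomial A A.+1 e0.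
  by apply/negP; rewrite -leNgt (le_trans (grow r)) // ler_nat size_divisors_exp_le.
exists (A ^ r)%N => // n /andP[n0 nM].
have nA : (n %| A)%N by rewrite dvdn_fact // n0.
have F0 : 0 < (size (F r))%:R :> R by rewrite lt_neqAle eq_sym divisors_neq0 /=.
set cnt := (\sum_(d <- divisors (A ^ r)) ((n * d %| A ^ r)%N : nat))%N.
have cntE : cnt = count (fun d => n * d %| A ^ r)%N (F r).
  by rewrite /cnt -big_mkcond sum1_count.
rewrite /fejer_weight -/cnt -/(F r) ler_pdivlMr // ler_pdivrMr // mul1r; apply/andP; split; last first.
  by rewrite ler_nat cntE count_size.
have le : (size (F r) + count (fun d => ~~ (n * d %| A ^ r)%N) (F r) <= size (F r.+1))%N.
  rewrite -size_filter -(size_map (muln n) [seq _ <- _ | _]) -size_cat; apply: uniq_leq_size.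
    rewrite cat_uniq /F divisors_uniq /=; apply/andP; split.
      apply/hasPn => x /mapP[y]; rewrite mem_filter => /andP[ny _] ->.
      by rewrite /F -dvdn_divisors.
    rewrite map_inj_uniq ?filter_uniq ?divisors_uniq // => x y /eqP.
    by rewrite eqn_pmul2l // => /eqP.
  move=> x; rewrite mem_cat => /orP[|/mapP[y]].
    by rewrite /F -!dvdn_divisors // expnS => xA; rewrite dvdn_mull.
  rewrite mem_filter /F -!dvdn_divisors // => /andP[_ yA] ->.
  by rewrite expnS dvdn_mul.
have E : (cnt + count (fun d => ~~ (n * d %| A ^ r)%N) (F r) = size (F r))%N.
  by rewrite cntE; exact: count_predC.
have {}le : (2 * size (F r) <= size (F r.+1) + cnt)%N by lia.
have : (2 * size (F r))%:R <= (size (F r.+1) + cnt)%:R :> R by rewrite ler_nat.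
rewrite natrM natrD => H2.
have := lerD H2 Hr; lra.
Qed.

End FejerWeight.

(** * Approximating the unit by convolution multiples *)

Section FejerMultiplier.
Context {R : realType}.
Implicit Types (a b c x : nat -> R[i]) (N M L : nat) (K : R).

(** As a function of t, the indicator of i F for the set F of divisors of L. *)
Definition cutoff L (i t : nat) : R := ((i %| t) && (t %/ i %| L))%N%:R.

(** The weights are, up to normalization, a Gram matrix: this is the positive
    definiteness of the kernel. *)
Lemma fejer_weight_gram L N (i j : nat) : (0 < L)%N -> (0 < i <= N)%N -> (j %| i)%N ->
  \sum_(1 <= t < (N * L).+1) cutoff L i t * cutoff L j t =
  (size (divisors L))%:R * fejer_weight L (i %/ j)%N.
Proof.
move=> L0 /andP[i0 iN] ji; have j0 := dvdn_gt0 i0 ji.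
rewrite (eq_bigr (fun t => if (i %| t)%N then ((t %/ i %| L)%N)%:R * cutoff L j t else 0)); last first.
  by move=> t _; rewrite /cutoff; case: (i %| t)%N => //=; rewrite mul0r.
rewrite -big_mkcond sum_multiples //=.
rewrite (eq_bigr (fun d => if (d %| L)%N then (((i %/ j) * d %| L)%N)%:R else 0)); last first.
  move=> d _; rewrite mulKn // /cutoff dvdn_mulr //= divn_mulAC //.
  by case: (d %| L)%N; rewrite ?mul1r ?mul0r.
rewrite -big_mkcond -sum_divisors //.
  by rewrite /fejer_weight mulrCA divff ?divisors_neq0 // mulr1 natr_sum.
move=> d Nd /(dvdn_leq L0); rewrite leqNgt (leq_ltn_trans _ Nd) //.
by rewrite leq_divRL // mulnC leq_mul2r iN orbT.
Qed.

Lemma fejer_weight_itv L (n : nat) : 0 <= (fejer_weight L n : R) <= 1.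
Proof.
have L0 : 0 < (size (divisors L))%:R :> R by rewrite lt_neqAle eq_sym divisors_neq0 /=.
rewrite /fejer_weight divr_ge0 //= ler_pdivrMr // mul1r ler_nat -sum1_size.
by apply: leq_sum => d _; case: (_ %| _)%N.
Qed.

Lemma fejer_weight1 L : fejer_weight L 1%N = 1 :> R.
Proof.
rewrite /fejer_weight (_ : (\sum_(d <- _) _ = size (divisors L))%N) ?divff ?divisors_neq0 //.
rewrite -sum1_size big_seq [RHS]big_seq; apply: eq_bigr => d.
case: (posnP L) => [->|L0]; first by rewrite dvdn0.
by rewrite -dvdn_divisors // mul1n => ->.
Qed.

Lemma fejer_weight_sq L N (i : nat) : (0 < L)%N -> (0 < i <= N)%N ->
  \sum_(1 <= t < (N * L).+1) sqn (cutoff L i t)%:C = (size (divisors L))%:R.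
Proof.
move=> L0 iN; have := fejer_weight_gram L0 iN (dvdnn i).
rewrite divnn (_ : (0 < i)%N = true); last by case/andP: iN.
by rewrite fejer_weight1 mulr1 => <-; apply: eq_bigr => t _; rewrite sqn_real expr2.
Qed.

(** Schur multiplication by a positive definite kernel with diagonal 1 does
    not increase the norm of an operator: the weighted convolution is an
    average, over t, of convolutions with b between cut-offs cutoff L _ t. *)
Lemma dconv_bounded_fejer K b L : (0 < L)%N -> 0 <= K -> dconv_bounded K b ->
  dconv_bounded K (fun n => (fejer_weight L n)%:C * b n).
Proof.
move=> L0 K0 bK N x.
pose tau : R := (size (divisors L))%:R.
have tau0 : 0 < tau by rewrite lt_neqAle eq_sym divisors_neq0 /=.
pose y t (j : nat) := (cutoff L j t)%:C * x j.
pose z t := dconv b (y t).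
have zE i : (0 < i <= N)%N -> dconv (fun n => (fejer_weight L n)%:C * b n) x i =
    (tau^-1)%:C * \sum_(1 <= t < (N * L).+1) (cutoff L i t)%:C * z t i.
  move=> iN; have i0 : (0 < i)%N by case/andP: iN.
  under [in RHS]eq_bigr do rewrite /z /dconv mulr_sumr.
  rewrite exchange_big /= mulr_sumr; apply: eq_big_seq => d; rewrite -dvdn_divisors // => di.
  have -> : fejer_weight L d = tau^-1 * \sum_(1 <= t < (N * L).+1) cutoff L i t * cutoff L (i %/ d)%N t.
    rewrite fejer_weight_gram ?dvdn_div // mulrA mulVf ?gt_eqF // mul1r.
    by rewrite divnA // mulKn.
  rewrite rmorphM rmorph_sum -!mulrA; congr (_ * _).
  rewrite mulr_suml; apply: eq_bigr => t _; rewrite /y rmorphM /=.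
  by ring.
have le i : (0 < i <= N)%N ->
    sqn (dconv (fun n => (fejer_weight L n)%:C * b n) x i) <=
    tau^-1 * \sum_(1 <= t < (N * L).+1) sqn (z t i).
  move=> iN; rewrite zE // sqnM sqn_real expr2 -mulrA ler_wpM2l ?invr_ge0 ?(ltW tau0) //.
  rewrite ler_pdivrMl //; apply: (le_trans (sqn_sum_mul _ _ _ _)).
  by rewrite fejer_weight_sq.
apply: (@le_trans _ _ (tau^-1 * \sum_(1 <= t < (N * L).+1) nsq N (z t))).
  rewrite exchange_big /= mulr_sumr /nsq big_nat [leRHS]big_nat.
  by apply: ler_sum => i iN; exact: le.
apply: (@le_trans _ _ (tau^-1 * \sum_(1 <= t < (N * L).+1) K * nsq N (y t))).
  by rewrite ler_wpM2l ?invr_ge0 ?(ltW tau0) //; apply: ler_sum => t _; exact: bK.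
rewrite -mulr_sumr mulrCA ler_wpM2l // exchange_big /= ler_pdivrMl // /nsq mulr_sumr.
rewrite big_nat [leRHS]big_nat; apply: ler_sum => i iN.
under eq_bigr do rewrite sqnM.
by rewrite -mulr_suml fejer_weight_sq.
Qed.

End FejerMultiplier.

Section ApproximateInverse.
Context {R : realType}.
Implicit Types (a b c x p : nat -> R[i]) (N M L : nat) (K : R).

(** The unit is in the closure of the convolution multiples p * a by finitely
    supported p. *)
Definition near_invertible a : Prop := forall e : R, 0 < e ->
  exists M p, (forall n, (M < n)%N -> p n = 0) /\
    forall N, nsq N (fun n => dconv p a n - delta1 n) <= e.

Lemma trunc_supp M c n : (M < n)%N -> trunc M c n = 0.
Proof. by rewrite /trunc ltnNge; case: leqP. Qed.

Lemma nsq_delta1 N : nsq N (delta1 : nat -> R[i]) <= 1.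
Proof.
rewrite (le_trans (@nsq_supp _ N 1 delta1 _)) //.
  by move=> n; rewrite /delta1; case: eqP => // ->.
by rewrite /nsq big_nat1 /delta1 eqxx sqn1.
Qed.

Lemma dconv_delta1 b (n : nat) : (0 < n)%N -> dconv b delta1 n = b n.
Proof.
move=> n0; rewrite /dconv (bigD1_seq n) ?divisors_uniq -?dvdn_divisors //=.
rewrite divnn n0 /delta1 eqxx mulr1 big_seq_cond big1 ?addr0 // => d.
rewrite -dvdn_divisors // => /andP[dn nd].
case: eqP => [E|_]; last by rewrite mulr0.
by move: nd; rewrite -(divnK dn) E mul1n eqxx.
Qed.

Lemma l2_dconv_bounded K b : 0 <= K -> dconv_bounded K b -> l2 b.
Proof.
move=> K0 bK; exists K => N; rewrite -(eq_nsq (u := dconv b delta1)).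
  rewrite (le_trans (bK N delta1)) // -[leRHS]mulr1 ler_wpM2l ?nsq_delta1 //.
by move=> n /andP[n0 _]; rewrite dconv_delta1.
Qed.

Section Cases.
Variables (a b : nat -> R[i]).
Hypothesis ba : forall n : nat, (0 < n)%N -> dconv b a n = delta1 n.

Lemma nsq_dconv_recip p N :
  nsq N (fun n => dconv p a n - delta1 n) = nsq N (dconv (fun n => b n - p n) a).
Proof.
rewrite -nsqN; apply: eq_nsq => n /andP[n0 _].
by rewrite dconvBl ba // opprB.
Qed.

(** Truncations p of b work: 1 - p * a = (b - p) * a is small by the weighted
    inequality. *)
Lemma near_invertible_weighted (Ka Kb : R) :
  (forall N, \sum_(1 <= n < N.+1) sqn (a n) * (size (divisors n))%:R <= Ka) ->
  (forall N, \sum_(1 <= n < N.+1) sqn (b n) * (size (divisors n))%:R <= Kb) ->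
  near_invertible a.
Proof.
move=> HKa HKb e e0.
have w0 c n : 0 <= sqn (c n) * (size (divisors n))%:R :> R by rewrite mulr_ge0 ?sqn_ge0.
have Ka0 : 0 <= Ka by apply: le_trans (HKa 0%N); rewrite big_geq.
have e1 : 0 < e / (Ka + 1) by rewrite divr_gt0 // ltr_wpDl.
have [M HM] := bounded_sum_tail (w0 b) HKb e1.
exists M, (trunc M b); split; first exact: trunc_supp.
move=> N; rewrite nsq_dconv_recip (le_trans (nsq_dconv_weighted _ _ _)) //.
apply: (@le_trans _ _ (e / (Ka + 1) * Ka)).
  have s0 c : 0 <= \sum_(1 <= n < N.+1) sqn (c n) * (size (divisors n))%:R :> R.
    by apply: sumr_ge0.
  apply: ler_pM; [exact: s0|exact: s0| |exact: HKa].
  apply: le_trans (HM N); apply: ler_sum => n _.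
  by rewrite /trunc; case: ifP; rewrite ?subrr ?sqn0 ?mul0r ?subr0.
by rewrite mulrAC ler_pdivrMr ?ltr_wpDl // ler_wpM2l ?ltW // ltrDl.
Qed.

(** Truncations p of b work: 1 - p * a is the image of the small vector b - p
    under the bounded convolution by a. *)
Lemma near_invertible_bounded_l K : 0 <= K -> dconv_bounded K a -> l2 b ->
  near_invertible a.
Proof.
move=> K0 aK bl2 e e0.
have e1 : 0 < e / (K + 1) by rewrite divr_gt0 // ltr_wpDl.
have [M HM] := l2_tail bl2 e1.
exists M, (trunc M b); split; first exact: trunc_supp.
move=> N; rewrite nsq_dconv_recip.
rewrite (eq_nsq (v := dconv a (fun n => b n - trunc M b n))); last first.
  by move=> n /andP[n0 _]; rewrite dconvC.
apply: (le_trans (aK N _)); apply: (@le_trans _ _ (K * (e / (K + 1)))).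
  by rewrite ler_wpM2l.
by rewrite mulrA ler_pdivrMr ?ltr_wpDl // mulrC ler_wpM2l ?ltW // ltrDl.
Qed.

(** Fejer means p of b satisfy the same bound as b and tend to b in l2; as
    finite sequences are dense, p * a tends to b * a. *)
Lemma near_invertible_bounded_r K : 0 <= K -> l2 a -> dconv_bounded K b ->
  near_invertible a.
Proof.
move=> K0 al2 bK e e0.
have [Kb HKb] := l2_dconv_bounded K0 bK.
have Kb0 : 0 <= Kb by apply: le_trans (HKb 0%N); exact: nsq_ge0.
(* the tail of a contributes 8 K e1 <= e / 2; the tail of b and the weights
   contribute 2 C (e2 + eta Kb) <= e / 2 *)
have e1 : 0 < e / (16 * (K + 1)) by rewrite divr_gt0 // mulr_gt0 // ltr_wpDl.
have [M HM] := l2_tail al2 e1.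
pose C : R := M%:R * nsq M (trunc M a) + 1.
have C0 : 0 < C by rewrite ltr_wpDl // mulr_ge0 ?nsq_ge0.
have e2 : 0 < e / (8 * C) by rewrite divr_gt0 // mulr_gt0.
have [M' HM'] := l2_tail (ex_intro _ Kb HKb) e2.
pose eta : R := Num.min 1 (e / (8 * C * (Kb + 1))).
have eta0 : 0 < eta.
  by rewrite lt_min ltr01 divr_gt0 // !mulr_gt0 // ltr_wpDl.
have eta1 : eta <= 1 by rewrite ge_min lexx.
have etaKb : eta * Kb <= e / (8 * C).
  apply: (@le_trans _ _ (e / (8 * C * (Kb + 1)) * Kb)).
    by rewrite ler_wpM2r // ge_min lexx orbT.
  have Kb1 : 0 < Kb + 1 by rewrite ltr_wpDl.
  rewrite (_ : _ * Kb = e / (8 * C) * (Kb / (Kb + 1))); last by field; rewrite !gt_eqF.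
  by rewrite ler_piMr ?(ltW e2) // ler_pdivrMr // mul1r lerDl.
have [L L0 HL] := fejer_weight_near1 M' eta0.
pose w := @fejer_weight R L.
pose p n := (w n)%:C * b n.
have pK : dconv_bounded K p by exact: dconv_bounded_fejer.
have p_supp n : (L < n)%N -> p n = 0.
  move=> Ln; rewrite /p /w /fejer_weight big_seq big1 ?mul0r // => d.
  rewrite -dvdn_divisors // => /(dvdn_gt0 L0) d0.
  case: (boolP (_ %| _)%N) => // /(dvdn_leq L0); rewrite leqNgt.
  by rewrite (leq_trans Ln) // leq_pmulr.
exists L, p; split => // N; rewrite nsq_dconv_recip.
have bp : nsq N (fun n => b n - p n) <= e / (8 * C) + e / (8 * C).
  apply: le_trans (lerD etaKb (HM' N)).
  apply: (@le_trans _ _ (eta * nsq N b + nsq N (fun n => b n - trunc M' b n))); last first.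
    by rewrite lerD2r ler_wpM2l // (ltW eta0).
  rewrite /nsq mulr_sumr -big_split /=; apply: ler_sum_nat => n /andP[n0 _].
  have -> : b n - p n = (1 - w n)%:C * b n.
    by rewrite /p rmorphB rmorph1 mulrBl mul1r.
  rewrite sqnM sqn_real /trunc.
  have /andP[w0 w1] : 0 <= w n <= 1 by exact: fejer_weight_itv.
  have [nM'|M'n] := leqP n M'.
    rewrite subrr sqn0 addr0 ler_wpM2r ?sqn_ge0 //.
    by have := HL n; rewrite n0 nM' => /(_ isT)/andP[+ _]; rewrite -/(w n); nra.
  rewrite subr0 -[leLHS]add0r lerD //; first by rewrite mulr_ge0 ?sqn_ge0 ?ltW.
  by rewrite ler_piMl ?sqn_ge0 //; nra.
rewrite (eq_nsq (v := fun n => dconv (fun k => b k - p k) (fun k => a k - trunc M a k) n +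
    dconv (fun k => b k - p k) (trunc M a) n)); last first.
  by move=> n _; rewrite dconvBr subrK.
apply: (le_trans (nsqD_le _ _ _)).
have H1 : nsq N (dconv (fun k => b k - p k) (fun k => a k - trunc M a k)) <=
    4 * K * (e / (16 * (K + 1))).
  rewrite (eq_nsq (v := fun n => dconv b (fun k => a k - trunc M a k) n -
    dconv p (fun k => a k - trunc M a k) n)); last by move=> n _; rewrite dconvBl.
  apply: (le_trans (nsqB_le _ _ _)).
  have := bK N (fun k => a k - trunc M a k); have := pK N (fun k => a k - trunc M a k).
  have := ler_wpM2l K0 (HM N); lra.
have H2 : nsq N (dconv (fun k => b k - p k) (trunc M a)) <= C * (e / (8 * C) + e / (8 * C)).
  apply: (le_trans (nsq_dconv_supp _ _ (@trunc_supp M a))).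
  apply: ler_pM => //; rewrite ?mulr_ge0 ?nsq_ge0 //.
  by rewrite lerDl.
have E1 : C * (e / (8 * C) + e / (8 * C)) = e / 4 by field; rewrite gt_eqF.
have E2 : 4 * K * (e / (16 * (K + 1))) <= e / 4.
  rewrite (_ : _ * _ = e / 4 * (K / (K + 1))); last by field; rewrite gt_eqF // ltr_wpDl.
  by rewrite ler_piMr ?divr_ge0 ?(ltW e0) // ler_pdivrMr ?mul1r ?lerDl // ltr_wpDl.
rewrite E1 in H2; lra.
Qed.

End Cases.
End ApproximateInverse.

(** * Dirichlet series and their asymptotic expansions *)

Local Open Scope classical_set_scope.

Section ComplexLimits.
Context {R : realType}.
Implicit Types (u : nat -> R[i]) (l z : R[i]).

Lemma normcE_real z : `|z| = (Normc.normc z)%:C.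
Proof. by case: z => x y; rewrite normc_def. Qed.

Lemma normc_sum_le (I : Type) (r : seq I) (P : pred I) (f : I -> R[i]) :
  Normc.normc (\sum_(i <- r | P i) f i) <= \sum_(i <- r | P i) Normc.normc (f i).
Proof.
elim/big_ind2: _ => //; first by rewrite Normc.normc0.
by move=> x1 x2 y1 y2 H1 H2; rewrite (le_trans (le_normcD _ _)) // lerD.
Qed.

Lemma cvg_normcP u l :
  ((u : nat -> (R[i])^o) @ \oo --> (l : (R[i])^o)) <->
  (forall e : R, 0 < e -> exists N, forall n, (N <= n)%N -> Normc.normc (l - u n) < e).
Proof.
split.
  move=> /cvgrPdist_lt H e e0.
  have /H[N _ HN] : (0 : R[i]) < e%:C by rewrite ltcR.
  by exists N => n /HN /=; rewrite normcE_real ltcR.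
move=> H; apply/cvgrPdist_lt => e e0.
have Ee : e = (complex.Re e)%:C.
  by case: e e0 => x y; rewrite ltcE /= => /andP[/eqP ->].
have [N HN] := H (complex.Re e) (ltac:(by move: e0; rewrite {1}Ee ltcR)).
by exists N => // n /= /HN H1; rewrite normcE_real Ee ltcR.
Qed.

Lemma normc_ge_Re z : `|complex.Re z| <= Normc.normc z.
Proof.
case: z => x y /=; rewrite -sqrtr_sqr ler_wsqrtr // lerDl sqr_ge0 //.
Qed.

Lemma normc_ge_Im z : `|complex.Im z| <= Normc.normc z.
Proof.
case: z => x y /=; rewrite -sqrtr_sqr ler_wsqrtr // lerDr sqr_ge0 //.
Qed.

Lemma normc_le_ReIm z : Normc.normc z <= `|complex.Re z| + `|complex.Im z|.
Proof.
case: z => x y /=; rewrite -[leRHS]ger0_norm ?addr_ge0 // -sqrtr_sqr ler_wsqrtr //.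
rewrite sqrrD !real_normK ?num_real // addrAC lerDl mulrn_wge0 // mulr_ge0 //.
Qed.

Lemma real_series_cvg (g : nat -> R) (K : R) :
  (forall N, \sum_(0 <= n < N) `|g n| <= K) ->
  exists l : R, forall e : R, 0 < e -> exists N, forall n, (N <= n)%N ->
    `|l - \sum_(0 <= k < n) g k| < e.
Proof.
move=> gK.
have : cvgn [normed series g].
  apply: nondecreasing_is_cvgn.
    move=> n m nm; rewrite /series /=; apply: ler_sum_nat_wide => //.
  by exists K => _ [N _ <-]; exact: gK.
move=> /normed_cvg g_cvg; exists (limn (series g)) => e e0.
have /cvgrPdist_lt/(_ e e0)[N _ HN] : series g @ \oo --> limn (series g) by exact: g_cvg.
by exists N => n /HN.
Qed.

Lemma absolutely_convergent (g : nat -> R[i]) (K : R) :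
  (forall N, \sum_(1 <= n < N.+1) Normc.normc (g n) <= K) ->
  exists l : R[i], forall e : R, 0 < e -> exists N, forall n, (N <= n)%N ->
    Normc.normc (l - \sum_(1 <= k < n.+1) g k) < e.
Proof.
move=> gK.
have Re_le N : \sum_(0 <= n < N) `|complex.Re (g n.+1)| <= K.
  apply: le_trans (gK N); rewrite big_add1 /=.
  by apply: ler_sum => n _; exact: normc_ge_Re.
have Im_le N : \sum_(0 <= n < N) `|complex.Im (g n.+1)| <= K.
  apply: le_trans (gK N); rewrite big_add1 /=.
  by apply: ler_sum => n _; exact: normc_ge_Im.
have [x Hx] := real_series_cvg Re_le; have [y Hy] := real_series_cvg Im_le.
exists (x +i* y) => e e0; have e2 : 0 < e / 2 by rewrite divr_gt0.
have [N1 HN1] := Hx _ e2; have [N2 HN2] := Hy _ e2.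
exists (maxn N1 N2) => n; rewrite geq_max => /andP[/HN1 H1 /HN2 H2].
apply: (le_lt_trans (normc_le_ReIm _)); rewrite (splitr e); apply: ltrD.
  rewrite raddfB raddf_sum /= big_add1 //.
by rewrite raddfB raddf_sum /= big_add1.
Qed.

End ComplexLimits.

Section Powers.
Context {R : realType}.
Implicit Types (n m : nat) (s t : R).

(** [npow_opp] at a real point, as a real number. *)
Definition pw n s : R := expR (- (s * ln n%:R)).

Lemma pw_gt0 n s : 0 < pw n s. Proof. exact: expR_gt0. Qed.

Lemma pw_ge0 n s : 0 <= pw n s. Proof. exact: expR_ge0. Qed.

Lemma npow_opp_real n s : npow_opp n s%:C = (pw n s)%:C.
Proof. by rewrite /npow_opp /= mul0r cos0 sin0 /pw oppr0 mulr1. Qed.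

Lemma normc_npow_opp n (s : R[i]) : Normc.normc (npow_opp n s) = pw n (complex.Re s).
Proof.
rewrite /npow_opp Normc.normcM /= expr0n addr0 sqrtr_sqr sqrrN cos2Dsin2 sqrtr1 mulr1.
by rewrite gtr0_norm // expR_gt0.
Qed.

Lemma pwD n s t : pw n (s + t) = pw n s * pw n t.
Proof. by rewrite /pw -expRD mulrDl opprD. Qed.

Lemma pwM n m s : (0 < n)%N -> (0 < m)%N -> pw (n * m) s = pw n s * pw m s.
Proof.
by move=> n0 m0; rewrite /pw -expRD natrM lnM ?posrE ?ltr0n // mulrDr opprD.
Qed.

Lemma pw_le n m s : (0 < n)%N -> (n <= m)%N -> 0 <= s -> pw m s <= pw n s.
Proof.
move=> n0 nm s0; rewrite /pw ler_expR lerN2 ler_wpM2l // ler_ln ?posrE ?ltr0n ?ler_nat //.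
exact: leq_trans nm.
Qed.

Lemma pw1 n : (0 < n)%N -> pw n 1 = n%:R^-1.
Proof. by move=> n0; rewrite /pw mul1r expRN lnK // posrE ltr0n. Qed.

Lemma pw_le1 n s : (0 < n)%N -> 0 <= s -> pw n s <= 1.
Proof.
move=> n0 s0; rewrite (le_trans (@pw_le 1 n s _ _ _)) //.
by rewrite /pw ln1 mulr0 oppr0 expR0.
Qed.

(** With D = ln n - ln (n + 1) <= - 1/(n + 1), one has
    n^(-s) = (n + 1)^(-s) exp (- s D) >= (n + 1)^(-s) (1 + s/(n + 1)). *)
Lemma pw_telescope n s : (0 < n)%N -> 0 < s ->
  pw n.+1 (1 + s) <= (pw n s - pw n.+1 s) / s.
Proof.
move=> n0 s0; have n0R : 0 < n%:R :> R by rewrite ltr0n.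
have n1R : 0 < n.+1%:R :> R by rewrite ltr0n.
pose D : R := ln n%:R - ln n.+1%:R.
have ED : expR D = n%:R / n.+1%:R by rewrite /D expRB !lnK.
have D_le : D <= - n.+1%:R^-1.
  have := expR_ge1Dx D; rewrite ED -(natr1 n); have : n%:R + 1 != 0 :> R by rewrite natr1.
  move=> nn0; rewrite (_ : n%:R / (n%:R + 1) = 1 - (n%:R + 1)^-1); last by field.
  lra.
have -> : pw n s = pw n.+1 s * expR (- (s * D)).
  by rewrite /pw -expRD; congr expR; rewrite /D; ring.
have H : n.+1%:R^-1 * s <= expR (- (s * D)) - 1.
  move: D_le; set v := _^-1 => D_le.
  have := expR_ge1Dx (- (s * D)).
  have : s * D <= s * (- v) by rewrite ler_pM2l.
  lra.
rewrite ler_pdivlMr // pwD pw1 //.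
have := ler_wpM2l (pw_ge0 n.+1 s) H; set v := _%:R^-1; set E := expR _.
by lra.
Qed.

Lemma sum_pw_le s N : 0 < s -> \sum_(1 <= n < N.+1) pw n (1 + s) <= 1 + s^-1.
Proof.
move=> s0; case: N => [|N]; first by rewrite big_geq // addr_ge0 ?invr_ge0 ?ltW.
have : \sum_(1 <= n < N.+2) pw n (1 + s) <= 1 + (1 - pw N.+1 s) / s.
  elim: N => [|N IH].
    by rewrite big_nat1 /pw ln1 !mulr0 oppr0 expR0 subrr mul0r addr0.
  rewrite big_nat_recr //=; have := @pw_telescope N.+1 s isT s0.
  move: IH; rewrite !mulrBl; lra.
move=> /le_trans; apply; rewrite lerD2l mulrBl mul1r gerBl.
by rewrite divr_ge0 ?pw_ge0 ?ltW.
Qed.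

End Powers.

Section Asymptotics.
Context {R : realType}.
Implicit Types (F G : R -> R[i]) (c e : nat -> R[i]) (n N : nat) (s : R).

(** [dirichlet_asymp F e]: along real s -> +oo, F has the asymptotic expansion
    sum_k e_k k^(-s).  The relation is multiplicative and determines the
    coefficients e_k by finite computations, without rearranging series. *)
Definition dirichlet_asymp F e : Prop := forall n, exists C s1 : R,
  forall s, s1 <= s ->
    Normc.normc (F s - \sum_(1 <= k < n.+1) e k * (pw k s)%:C) <= C * pw n.+1 s.

Lemma normc_real_ge0 (x : R) : 0 <= x -> Normc.normc x%:C = x.
Proof. by move=> x0; rewrite /= expr0n addr0 sqrtr_sqr ger0_norm. Qed.

(** The coefficients of a series convergent at s2 are O(k^s2).  For s >= s2 + 2
    the k-th term is then O((n + 1)^(-s) k^(-2)) uniformly in k > n, and the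
    factors k^(-2) have a bounded sum. *)
Lemma dirichlet_sum_asymp c F (s0 : R) :
  (forall s, s0 < s -> dirichlet_sum c s%:C (F s)) -> dirichlet_asymp F c.
Proof.
move=> cF n; pose s2 : R := s0 + 1.
pose S s N := \sum_(1 <= k < N.+1) c k * (pw k s)%:C.
have Slim s : s0 < s -> forall e : R, 0 < e -> exists N, forall m, (N <= m)%N ->
    Normc.normc (F s - S s m) < e.
  move=> /cF /cvg_normcP H e e0; have [N HN] := H e e0; exists N => m /HN.
  by under eq_bigr do rewrite npow_opp_real.
have [B [B0 HB]] : exists B : R, 0 <= B /\
    forall k, (0 < k)%N -> Normc.normc (c k) * pw k s2 <= B.
  have [|N HN] := Slim s2 _ 1 ltr01; first by rewrite ltrDl.
  exists (2 + \sum_(1 <= k < N.+1) Normc.normc (c k) * pw k s2).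
  have g0 k : 0 <= Normc.normc (c k) * pw k s2 by rewrite mulr_ge0 ?normc_ge0 ?pw_ge0.
  split; first by rewrite addr_ge0 ?sumr_ge0.
  move=> k k0; have [kN|Nk] := leqP k N.
    rewrite (bigD1_seq k) ?iota_uniq ?mem_index_iota ?k0 //=.
    by rewrite addrCA lerDl addr_ge0 // sumr_ge0.
  apply: (@le_trans _ _ 2); last by rewrite lerDl sumr_ge0.
  case: k Nk {k0} => // k Nk.
  have := HN _ (Nk : (N <= k)%N); have := HN _ (leqW Nk : (N <= k.+1)%N).
  rewrite {1}/S big_nat_recr //= -/(S s2 k) => H1 H2.
  rewrite -[pw _ _]normc_real_ge0 ?pw_ge0 // -Normc.normcM.
  rewrite (_ : _ * _ = (F s2 - S s2 k) - (F s2 - (S s2 k + c k.+1 * (pw k.+1 s2)%:C))).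
    rewrite (le_trans (le_normcD _ _)) // normcN (_ : 2 = 1 + 1) // lerD // ltW //.
  by rewrite opprB addrC addrA subrK addrC addKr.
exists (2 * B * (pw n.+1 (s2 + 2))^-1), (s2 + 2) => s s_ge.
apply/ler_addgt0Pr => e e0.
have [|N HN] := Slim s _ e e0; first by rewrite (lt_le_trans _ s_ge) // /s2 -addrA ltrDl.
have {}HN := HN (maxn n N) (leq_maxr _ _).
set M := maxn n N in HN.
have nM : (n <= M)%N by rewrite leq_maxl.
suff HM : Normc.normc (S s M - S s n) <= 2 * B * (pw n.+1 (s2 + 2))^-1 * pw n.+1 s.
  have -> : F s - S s n = (S s M - S s n) + (F s - S s M) by ring.
  by rewrite (le_trans (le_normcD _ _)) // lerD // ltW.
rewrite {1}/S (@big_cat_nat _ _ _ n.+1) //= -/(S s n) [X in X - _]addrC addrK.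
apply: (le_trans (normc_sum_le _ _ _)).
pose r := s - (s2 + 2); have r0 : 0 <= r by rewrite subr_ge0.
have En : pw n.+1 s = pw n.+1 (s2 + 2) * pw n.+1 r.
  by rewrite -pwD; congr pw; rewrite /r; ring.
rewrite En mulrA mulfVK ?gt_eqF ?pw_gt0 //.
have le k : (n < k)%N -> Normc.normc (c k * (pw k s)%:C) <= B * pw n.+1 r * pw k (1 + 1).
  move=> nk; have k0 : (0 < k)%N by exact: leq_ltn_trans nk.
  rewrite Normc.normcM normc_real_ge0 ?pw_ge0 //.
  have -> : s = s2 + r + (1 + 1) by rewrite /r; ring.
  rewrite !(pwD k (s2 + r)) (pwD k s2) !mulrA ler_wpM2r ?pw_ge0 // ler_pM ?HB //.
  - by rewrite mulr_ge0 ?normc_ge0 ?pw_ge0.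
  - exact: pw_ge0.
  - exact: pw_le.
apply: (@le_trans _ _ (\sum_(n.+1 <= k < M.+1) B * pw n.+1 r * pw k (1 + 1))).
  by apply: ler_sum_nat => k /andP[nk _]; exact: le.
rewrite -mulr_sumr (_ : 2 * B * pw n.+1 r = B * pw n.+1 r * 2); last by ring.
rewrite ler_wpM2l ?mulr_ge0 ?pw_ge0 //.
have := @sum_pw_le R 1 M ltr01; rewrite invr1; apply: le_trans.
by rewrite [leRHS](@big_cat_nat _ _ _ n.+1) //= lerDr sumr_ge0 // => *; exact: pw_ge0.
Qed.

(** At the first index n where e and c differ, the two expansions force
    (e n - c n) n^(-s) to be O((n + 1)^(-s)). *)
Lemma dirichlet_asymp_unique F e c : dirichlet_asymp F e -> dirichlet_asymp F c ->
  forall n, (0 < n)%N -> e n = c n.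
Proof.
move=> Fe Fc; elim/ltn_ind => n IH n0.
have [C1 [s1 H1]] := Fe n; have [C2 [s2 H2]] := Fc n.
apply/eqP; rewrite -subr_eq0; apply/eqP/Normc.eq0_normc.
pose D : R := ln n.+1%:R - ln n%:R.
have D0 : 0 < D by rewrite subr_gt0 ltr_ln ?posrE ?ltr0n // ltr_nat.
have H s : s1 <= s -> s2 <= s ->
    Normc.normc (e n - c n) <= (C1 + C2) * expR (- (s * D)).
  move=> /H1 {}H1 /H2 {}H2.
  have : Normc.normc ((e n - c n) * (pw n s)%:C) <= (C1 + C2) * pw n.+1 s.
    have -> : (e n - c n) * (pw n s)%:C =
        - (F s - \sum_(1 <= k < n.+1) e k * (pw k s)%:C) +
        (F s - \sum_(1 <= k < n.+1) c k * (pw k s)%:C).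
      rewrite !(big_nat_recr n) //= (eq_big_nat _ _ (F2 := fun k => c k * (pw k s)%:C)).
        by ring.
      by move=> k /andP[k0 kn]; rewrite IH.
    by rewrite [leRHS]mulrDl (le_trans (le_normcD _ _)) // normcN lerD.
  rewrite Normc.normcM normc_real_ge0 ?pw_ge0 // -ler_pdivlMr ?pw_gt0 // => /le_trans; apply.
  rewrite -mulrA /pw -expRN -expRD /D.
  rewrite (_ : - (s * ln n.+1%:R) - - (s * ln n%:R) = - (s * (ln n.+1%:R - ln n%:R))) //.
  by ring.
apply/eqP; rewrite eq_le normc_ge0 andbT leNgt; apply/negP => pos.
set x := Normc.normc _ in H pos.
have C0 : 0 < C1 + C2.
  have := H (Num.max s1 s2); rewrite !le_max !lexx orbT => /(_ isT isT) le.
  by move: (lt_le_trans pos le); rewrite pmulr_lgt0 ?expR_gt0.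
(* at s with s D >= (C1 + C2)/x the bound is smaller than x *)
pose s := Num.max (Num.max s1 s2) ((C1 + C2) / x / D).
have le1 : x <= (C1 + C2) * expR (- (s * D)) by apply: H; rewrite !le_max !lexx ?orbT.
have le2 : (C1 + C2) / x <= s * D by rewrite -ler_pdivrMr // /s le_max lexx orbT.
move: le1; rewrite expRN ler_pdivlMr ?expR_gt0 // => le1.
have := expR_ge1Dx (s * D).
have : (C1 + C2) <= s * D * x by rewrite -ler_pdivrMr.
nra.
Qed.

(** Multiplying the partial sums up to n, the pairs i, j with i j <= n give the
    partial sum of the convolution, and the other pairs are O((n + 1)^(-s)). *)
Lemma dirichlet_asympM F G e c : dirichlet_asymp F e -> dirichlet_asymp G c ->
  dirichlet_asymp (fun s => F s * G s) (dconv e c).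
Proof.
move=> Fe Gc n; have [C1 [s1 H1]] := Fe n; have [C2 [s2 H2]] := Gc n.
pose A s := \sum_(1 <= k < n.+1) e k * (pw k s)%:C.
pose B s := \sum_(1 <= k < n.+1) c k * (pw k s)%:C.
pose nA : R := \sum_(1 <= k < n.+1) Normc.normc (e k).
pose nB : R := \sum_(1 <= k < n.+1) Normc.normc (c k).
have sumle (u : nat -> R[i]) s : 0 <= s ->
    Normc.normc (\sum_(1 <= k < n.+1) u k * (pw k s)%:C) <=
    \sum_(1 <= k < n.+1) Normc.normc (u k).
  move=> s_ge0; apply: (le_trans (normc_sum_le _ _ _)).
  apply: ler_sum_nat => k /andP[k0 _].
  by rewrite Normc.normcM normc_real_ge0 ?pw_ge0 // ler_piMr ?normc_ge0 // pw_le1.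
have AB s : 0 <= s -> Normc.normc (A s * B s - \sum_(1 <= k < n.+1) dconv e c k * (pw k s)%:C) <=
    nA * nB * pw n.+1 s.
  move=> s_ge0.
  have -> : \sum_(1 <= k < n.+1) dconv e c k * (pw k s)%:C =
      \sum_(1 <= i < n.+1) \sum_(1 <= j < n.+1 | (i * j <= n)%N) e i * c j * (pw (i * j) s)%:C.
    rewrite (eq_big_nat _ _ (F2 := fun k => \sum_(1 <= i < n.+1 | (i %| k)%N)
        e i * c (k %/ i)%N * (pw k s)%:C)); last first.
      move=> k /andP[k0 kn]; rewrite /dconv (@sum_divisors _ k n) // ?mulr_suml //.
      by move=> j nj /(dvdn_leq k0) jk; lia.
    rewrite (exchange_big_dep xpredT) //=; apply: eq_big_nat => i /andP[i0 _].
    rewrite sum_multiples // (@big_nat_widen _ _ _ 1 (n %/ i).+1 n.+1) ?ltnS ?leq_div //.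
    apply: eq_big => [j|j _]; last by rewrite mulKn.
    by rewrite /= ltnS leq_divRL // mulnC.
  rewrite /A /B big_distrlr /= -sumrB.
  rewrite (eq_big_nat _ _ (F2 := fun i => \sum_(1 <= j < n.+1 | ~~ (i * j <= n)%N)
      e i * c j * (pw (i * j) s)%:C)); last first.
    move=> i /andP[i0 _]; rewrite (bigID (fun j => i * j <= n)%N) /= addrC.
    rewrite big_nat_cond [X in _ + X - _]big_nat_cond [X in _ - X]big_nat_cond.
    have E (P : pred nat) : \sum_(1 <= j < n.+1 | (1 <= j < n.+1)%N && P j)
        e i * (pw i s)%:C * (c j * (pw j s)%:C) =
      \sum_(1 <= j < n.+1 | (1 <= j < n.+1)%N && P j) e i * c j * (pw (i * j) s)%:C.
      by apply: eq_bigr => j /andP[/andP[j0 _] _]; rewrite pwM // rmorphM /=; ring.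
    by rewrite !E addrK -big_nat_cond.
  apply: (le_trans (normc_sum_le _ _ _)).
  rewrite /nA /nB -mulrA mulr_suml; apply: ler_sum_nat => i /andP[i0 _].
  apply: (le_trans (normc_sum_le _ _ _)).
  rewrite mulr_suml mulr_sumr [leRHS](bigID (fun j => i * j <= n)%N) /= -[leLHS]add0r lerD //.
    by apply: sumr_ge0 => j _; rewrite !mulr_ge0 ?normc_ge0 ?pw_ge0.
  rewrite big_nat_cond [leRHS]big_nat_cond.
  apply: ler_sum => j /andP[/andP[j0 _]]; rewrite -ltnNge => nij.
  rewrite !Normc.normcM mulrA ler_wpM2l ?mulr_ge0 ?normc_ge0 //.
  by rewrite normc_real_ge0 ?pw_ge0 // pw_le.
exists (`|C1| * (nB + `|C2|) + nA * `|C2| + nA * nB), (Num.max 0 (Num.max s1 s2)) => s.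
rewrite !ge_max => /and3P[s_ge0 /H1 {}H1 /H2 {}H2].
rewrite -/(A s) in H1; rewrite -/(B s) in H2.
have {}H1 : Normc.normc (F s - A s) <= `|C1| * pw n.+1 s.
  by rewrite (le_trans H1) // ler_wpM2r ?pw_ge0 ?ler_norm.
have {}H2 : Normc.normc (G s - B s) <= `|C2| * pw n.+1 s.
  by rewrite (le_trans H2) // ler_wpM2r ?pw_ge0 ?ler_norm.
have G_le : Normc.normc (G s) <= nB + `|C2|.
  rewrite -(subrK (B s) (G s)) addrC (le_trans (le_normcD _ _)) // lerD ?sumle //.
  by rewrite (le_trans H2) // ler_piMr ?pw_le1.
rewrite (_ : _ - _ = (F s - A s) * G s + A s * (G s - B s) +
   (A s * B s - \sum_(1 <= k < n.+1) dconv e c k * (pw k s)%:C)); last by ring.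
rewrite (le_trans (le_normcD _ _)) // [leRHS]mulrDl lerD ?AB //.
rewrite (le_trans (le_normcD _ _)) // [leRHS]mulrDl lerD // Normc.normcM.
  by rewrite mulrAC ler_pM ?normc_ge0.
by rewrite -mulrA ler_pM ?normc_ge0 ?sumle.
Qed.

End Asymptotics.

(** * Multipliers of H *)

Section Multipliers.
Context {R : realType}.
Implicit Types (a b c e : nat -> R[i]) (m : R[i] -> R[i]).

Lemma bounded_sums_eseries (g : nat -> R) : (forall n, 0 <= g n) ->
  ((\sum_(1 <= n <oo) (g n)%:E < +oo)%E <->
   exists K, forall N, \sum_(1 <= n < N.+1) g n <= K).
Proof.
move=> g0; have gE n : (1 <= n)%N -> true -> (0 <= (g n)%:E)%E by move=> *; rewrite lee_fin.
split.
  move=> fin; exists (fine (\sum_(1 <= n <oo) (g n)%:E)%E) => N.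
  rewrite -lee_fin fineK; last first.
    by rewrite ge0_fin_numE // nneseries_ge0.
  by rewrite -sumEFin; exact: nneseries_lim_ge.
move=> [K HK]; apply: (@le_lt_trans _ _ K%:E); last exact: ltry.
apply: lime_le; first exact: is_cvg_nneseries.
apply: nearW => -[|N]; last by rewrite sumEFin lee_fin.
by rewrite big_geq // lee_fin (le_trans _ (HK 0%N)) // sumr_ge0.
Qed.

Lemma series_in_HP c : series_in_H c <-> l2 c.
Proof. exact: (bounded_sums_eseries (fun n => sqn_ge0 (c n))). Qed.

(** For Re s = t > 1/2, |c_n n^(-s)| <= |c_n|^2 + n^(-2t) is summable. *)
Lemma l2_in_H c : l2 c -> exists2 f : R[i] -> R[i], in_H f &
  forall s, 2^-1 < complex.Re s -> dirichlet_sum c s (f s).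
Proof.
move=> [K HK].
have ex s : exists l, 2^-1 < complex.Re s -> dirichlet_sum c s l.
  have [s1|s1] := boolP (2^-1 < complex.Re s); last by exists 0.
  set t := complex.Re s in s1 *.
  have d0 : 0 < 2 * t - 1 by lra.
  have [|l Hl] := @absolutely_convergent R (fun n => c n * npow_opp n s) (K + (1 + (2 * t - 1)^-1)).
    move=> N; apply: le_trans (lerD (HK N) (sum_pw_le N d0)).
    rewrite -big_split /=; apply: ler_sum => n _.
    rewrite Normc.normcM normc_npow_opp -/t /sqn.
    rewrite (_ : 1 + (2 * t - 1) = t + t); last by ring.
    rewrite pwD; have := normc_ge0 (c n); have := pw_ge0 n t.
    set x := Normc.normc _; set y := pw _ _ => y0 x0.
    have := sqr_ge0 (x - y); nra.
  by exists l => _; apply/cvg_normcP.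
have /choice[f fP] := ex.
by exists f => //; exists c => //; apply/series_in_HP; exists K.
Qed.

(** The product of the multiplier and the function of c is in H by definition;
    comparing asymptotic expansions, its coefficients are those of a * c. *)
Lemma multiplier_l2_dconv a : series_in_M a -> forall c, l2 c -> l2 (dconv a c).
Proof.
move=> [m [_ mH] [sigma am]] c /l2_in_H[f /mH[e eH ef] cf].
have H1 : dirichlet_asymp (fun s => m s%:C) a.
  by apply: (@dirichlet_sum_asymp _ _ _ sigma) => s s0; exact: am.
have H2 : dirichlet_asymp (fun s => f s%:C) c.
  by apply: (@dirichlet_sum_asymp _ _ _ 2^-1) => s s0; exact: cf.
have H3 : dirichlet_asymp (fun s => m s%:C * f s%:C) e.
  by apply: (@dirichlet_sum_asymp _ _ _ 2^-1) => s s0; exact: ef.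
have /series_in_HP[K HK] := eH; exists K => N.
rewrite (eq_nsq (v := e)) // => n /andP[n0 _].
exact: (dirichlet_asymp_unique (dirichlet_asympM H1 H2) H3).
Qed.

Lemma l2_near_invertible a b : a 1%N = 1 -> is_reciprocal a b ->
  [\/ series_in_Hd a /\ series_in_Hd b,
      series_in_M a /\ series_in_H b |
      series_in_H a /\ series_in_M b] ->
  l2 a /\ near_invertible a.
Proof.
move=> a1 [b1 brec].
have ba n : (0 < n)%N -> dconv b a n = delta1 n.
  rewrite leq_eqVlt => /orP[/eqP <-|n1]; first by rewrite /dconv big_seq1 b1 mul1r a1.
  by rewrite /dconv brec // /delta1 gtn_eqF.
have w0 c n : 0 <= sqn (c n) * (size (divisors n))%:R :> R by rewrite mulr_ge0 ?sqn_ge0.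
move=> [[aHd bHd]|[aM bH]|[aH bM]].
- have /(bounded_sums_eseries (w0 a))[Ka HKa] := aHd.
  have /(bounded_sums_eseries (w0 b))[Kb HKb] := bHd.
  split; last exact: near_invertible_weighted HKa HKb.
  exists Ka => N; apply: le_trans (HKa N); apply: ler_sum_nat => n /andP[n0 _].
  by rewrite ler_peMr ?sqn_ge0 // ler1n lt0n -(pnatr_eq0 R) divisors_neq0.
- have [K K0 HK] := dconv_uniform_bound (multiplier_l2_dconv aM).
  have bl2 : l2 b by apply/series_in_HP.
  split; first exact: l2_dconv_bounded HK.
  exact: near_invertible_bounded_l HK bl2.
- have [K K0 HK] := dconv_uniform_bound (multiplier_l2_dconv bM).
  have al2 : l2 a by apply/series_in_HP.
  split => //; exact: near_invertible_bounded_r HK.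
Qed.

End Multipliers.

(** * The quadratic norm on (0,1) *)

Section QuadraticNorm.
Context {R : realType}.
Local Notation mu := (@lebesgue_measure R).
Local Notation I01 := (`]0%R, 1%R[%classic : set R).
Implicit Types (f g h : R -> R) (e : R).

Lemma measurable_I01 : measurable I01. Proof. exact: measurable_itv. Qed.

(** The square of the norm of L^2(0,1).  Working with squares, the triangle
    inequality is replaced by |f + g|^2 <= 2 |f|^2 + 2 |g|^2. *)
Definition qnorm f : \bar R := (\int[mu]_(x in I01) (f x ^+ 2)%:E)%E.

Local Notation mf := (measurable_fun I01).

Lemma measurable_EFin_sq f : mf f -> mf (fun x => (f x ^+ 2)%:E).
Proof. by move=> ff; apply/measurable_EFinP; exact: measurable_funX. Qed.

Lemma qnorm_ge0 f : (0 <= qnorm f)%E.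
Proof. by apply: integral_ge0 => x _; rewrite lee_fin sqr_ge0. Qed.

Lemma eq_qnorm f g : {in I01, f =1 g} -> qnorm f = qnorm g.
Proof. by move=> fg; apply: eq_integral => x xI; rewrite fg. Qed.

Lemma qnorm_le f g : mf f -> mf g -> (forall x, I01 x -> `|f x| <= `|g x|) ->
  (qnorm f <= qnorm g)%E.
Proof.
move=> ff gg fg; apply: ge0_le_integral => //=.
- by move=> x _; rewrite lee_fin sqr_ge0.
- exact: measurable_EFin_sq.
- exact: measurable_EFin_sq.
move=> x xI; rewrite lee_fin -(real_normK (num_real (f x))) -(real_normK (num_real (g x))).
by rewrite lerXn2r ?nnegrE ?fg.
Qed.

Lemma qnormZ (k : R) f : mf f -> qnorm (fun x => k * f x) = ((k ^+ 2)%:E * qnorm f)%E.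
Proof.
move=> ff; rewrite /qnorm -ge0_integralZl //=.
- by apply: eq_integral => x _; rewrite -EFinM exprMn.
- exact: measurable_EFin_sq.
- by move=> x _; rewrite lee_fin sqr_ge0.
- by rewrite lee_fin sqr_ge0.
Qed.

Lemma qnormD_le f g : mf f -> mf g ->
  (qnorm (fun x => (f x + g x)%R) <= 2%:E * qnorm f + 2%:E * qnorm g)%E.
Proof.
move=> ff gg; rewrite /qnorm -!ge0_integralZl ?measurable_I01 ?lee_fin //=; last 4 first.
- exact: measurable_EFin_sq.
- by move=> x _; rewrite lee_fin sqr_ge0.
- exact: measurable_EFin_sq.
- by move=> x _; rewrite lee_fin sqr_ge0.
have H h : mf h -> mf (fun x => (2%:E * (h x ^+ 2)%:E)%E).
  move=> hh; apply: (eq_measurable_fun (fun x => (2 * h x ^+ 2)%:E)) => //.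
  by apply/measurable_EFinP; apply: measurable_funM => //; exact: measurable_funX.
rewrite -ge0_integralD ?measurable_I01 //=; last 4 first.
- by move=> x _; rewrite -EFinM lee_fin mulr_ge0 ?sqr_ge0.
- exact: H.
- by move=> x _; rewrite -EFinM lee_fin mulr_ge0 ?sqr_ge0.
- exact: H.
apply: ge0_le_integral => //=.
- by move=> x _; rewrite lee_fin sqr_ge0.
- by apply: measurable_EFin_sq; exact: measurable_funD.
- by apply: emeasurable_funD; exact: H.
move=> x _; rewrite -!EFinM -EFinD lee_fin.
by have := sqr_ge0 (f x - g x); nra.
Qed.

Lemma qnormD_lt f g e : mf f -> mf g -> (qnorm f < (e / 4)%:E)%E ->
  (qnorm g < (e / 4)%:E)%E -> (qnorm (fun x => (f x + g x)%R) < e%:E)%E.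
Proof.
move=> ff gg fe ge; apply: (le_lt_trans (qnormD_le ff gg)).
have -> : e%:E = (2%:E * (e / 4)%:E + 2%:E * (e / 4)%:E)%E.
  by rewrite -!EFinM -EFinD; congr EFin; field.
apply: lteD; rewrite lte_pmul2l //.
Qed.

Lemma qnorm_dominated (f_ : nat -> R -> R) f g e :
  (forall n, mf (f_ n)) -> mf f -> mf g -> (qnorm g < +oo)%E -> 0 < e ->
  (forall n x, I01 x -> `|f_ n x| <= g x) -> (forall x, I01 x -> `|f x| <= g x) ->
  {ae mu, forall x, I01 x -> (fun n => f_ n x) @ \oo --> f x} ->
  exists n, (qnorm (fun x => (f x - f_ n x)%R) < e%:E)%E.
Proof.
move=> mf_ ff gg g2 e0 f_g fg ae.
have [|||||_ _] := @dominated_convergence _ _ R mu I01 measurable_I01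
  (fun n x => ((f x - f_ n x) ^+ 2)%:E) (cst 0%E) (fun x => ((2 * g x) ^+ 2)%:E).
- by move=> n; apply: measurable_EFin_sq; exact: measurable_funB.
- exact: measurable_cst.
- apply: (@filterS _ _ (ae_filter_ringOfSetsType mu) _ _ _ ae) => x H /H {}H; apply/fine_cvgP; split; first exact: nearW.
  rewrite [X in _ --> X](_ : _ = (f x - f x) ^+ 2); last by rewrite subrr expr0n.
  apply: (@cvg_comp _ _ _ (fun n => f x - f_ n x) (fun y => y ^+ 2) _ (nbhs (f x - f x))).
    by apply: cvgB => //; exact: cvg_cst.
  exact: exprn_continuous.
- apply/integrableP; split.
    by apply: measurable_EFin_sq; apply: measurable_funM.
  apply: (@le_lt_trans _ _ (qnorm (fun x => (2 * g x)%R))).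
    rewrite le_eqVlt; apply/orP; left; apply/eqP; apply: eq_integral => x _.
    by rewrite gee0_abs // lee_fin sqr_ge0.
  rewrite qnormZ // lte_mul_pinfty ?lee_fin ?sqr_ge0 //.
- apply: aeW => x n xI; rewrite gee0_abs ?lee_fin ?sqr_ge0 //.
  rewrite -[leLHS](real_normK (num_real _)) lerXn2r ?nnegrE //.
    by rewrite mulr_ge0 // (le_trans _ (fg x xI)).
  by rewrite (le_trans (ler_normB _ _)) // mulrDl mul1r lerD ?fg ?f_g.
rewrite integral0 => /fine_cvgP[fin cv].
have /cvgrPdist_lt/(_ e e0) := cv.
move=> cv'; have [n [fin_n lt_n]] := filter_ex (filterI fin cv').
exists n; rewrite -[X in (X < _)%E]fineK // lte_fin.
move: lt_n; rewrite sub0r normrN /= ger0_norm //.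
by apply: fine_ge0; exact: qnorm_ge0.
Qed.

End QuadraticNorm.

(** * Combinations of sines *)

Section SinePolynomials.
Context {R : realType}.
Local Notation mu := (@lebesgue_measure R).
Local Notation I01 := (`]0%R, 1%R[%classic : set R).
Local Notation mf := (measurable_fun I01).
Implicit Types (f g h P : R -> R) (e : R).

Definition sine (n : nat) (x : R) : R := Num.sqrt 2 * sin (n%:R * pi * x).

Lemma measurable_sine n D : measurable_fun D (sine n).
Proof.
apply: measurable_funM => //; apply: (@measurable_funTS _ _ _ _ D).
apply: (measurableT_comp (f := sin)); first by apply: continuous_measurable_fun; exact: continuous_sin.
exact: measurable_funM.
Qed.

Lemma measurable_sum_sine (c : nat -> R) N D :
  measurable_fun D (fun x => \sum_(1 <= n < N.+1) c n * sine n x).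
Proof.
by apply: measurable_sum => n; apply: measurable_funM => //; exact: measurable_sine.
Qed.

Definition sine_poly P : Prop := exists N (c : nat -> R),
  forall x, P x = \sum_(1 <= n < N.+1) c n * sine n x.

Lemma measurable_sine_poly P : sine_poly P -> mf P.
Proof.
move=> [N [c PE]]; rewrite (_ : P = fun x => \sum_(1 <= n < N.+1) c n * sine n x).
  exact: measurable_sum_sine.
exact/funext.
Qed.

Lemma sine_poly_sine n : sine_poly (sine n).
Proof.
case: n => [|n].
  exists 0%N, (fun=> 0) => x; rewrite big_geq // /sine.
  by rewrite !mul0r sin0 mulr0.
exists n.+1, (fun k => (k == n.+1)%:R) => x.
rewrite big_nat_recr //= eqxx mul1r big_nat big1 ?add0r // => k /andP[_ kn].
by rewrite ltn_eqF // mul0r.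
Qed.

Lemma sine_polyZ (k : R) P : sine_poly P -> sine_poly (fun x => k * P x).
Proof.
move=> [N [c PE]]; exists N, (fun n => k * c n) => x.
by rewrite PE mulr_sumr; apply: eq_bigr => n _; rewrite mulrA.
Qed.

Lemma sine_polyD P Q : sine_poly P -> sine_poly Q -> sine_poly (fun x => P x + Q x).
Proof.
move=> [N [c PE]] [M [d QE]].
have wide (K L : nat) (u : nat -> R) x : (K <= L)%N ->
    \sum_(1 <= n < K.+1) u n * sine n x =
    \sum_(1 <= n < L.+1) (if (n <= K)%N then u n else 0) * sine n x.
  move=> KL; rewrite (@big_nat_widen _ _ _ 1 K.+1 L.+1) //= big_mkcond /=.
  by apply: eq_bigr => n _; rewrite ltnS; case: ifP => // _; rewrite mul0r.
exists (maxn N M), (fun n => (if (n <= N)%N then c n else 0) + (if (n <= M)%N then d n else 0)).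
move=> x; rewrite PE QE (wide N (maxn N M)) ?leq_maxl // (wide M (maxn N M)) ?leq_maxr //.
by rewrite -big_split /=; apply: eq_bigr => n _; rewrite -mulrDl.
Qed.

Lemma sine_poly_sum (I : Type) (r : seq I) (F : I -> R -> R) :
  (forall i, sine_poly (F i)) -> sine_poly (fun x => \sum_(i <- r) F i x).
Proof.
move=> HF; elim: r => [|i r IH].
  by exists 0%N, (fun=> 0) => x; rewrite big_nil big_geq.
rewrite (_ : (fun x => _) = fun x => F i x + \sum_(j <- r) F j x).
  exact: sine_polyD.
by apply/funext => x; rewrite big_cons.
Qed.

(** By 2 sin u cos v = sin (u + v) + sin (u - v). *)
Lemma sine_poly_cos P : sine_poly P -> sine_poly (fun x => P x * cos (pi * x)).
Proof.
move=> [N [c PE]].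
rewrite (_ : (fun x => _) = fun x => \sum_(n <- index_iota 1 N.+1)
    (c n / 2) * (sine n.+1 x + sine n.-1 x)).
  apply: sine_poly_sum => n; apply: sine_polyZ; apply: sine_polyD; exact: sine_poly_sine.
apply/funext => x; rewrite PE mulr_suml; apply: eq_big_nat => n /andP[n0 _].
have E1 : n.+1%:R * pi * x = n%:R * pi * x + pi * x :> R by rewrite -natr1; ring.
have E2 : n.-1%:R * pi * x = n%:R * pi * x - pi * x :> R.
  by rewrite -subn1 natrB //; ring.
by rewrite /sine E1 E2 sinD sinB; field.
Qed.

Lemma sine_poly_horner P (q : {poly R}) : sine_poly P ->
  sine_poly (fun x => P x * q.[cos (pi * x)]).
Proof.
move=> PP; elim/poly_ind: q => [|q c IH].
  rewrite (_ : (fun x => _) = fun x => 0 * P x); first exact: sine_polyZ.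
  by apply/funext => x; rewrite horner0 mulr0 mul0r.
rewrite (_ : (fun x => _) =
    fun x => (P x * q.[cos (pi * x)]) * cos (pi * x) + c * P x).
  by apply: sine_polyD; [exact: sine_poly_cos|exact: sine_polyZ].
by apply/funext => x; rewrite hornerMXaddC mulrDr mulrA [P x * c]mulrC.
Qed.

Definition approximable f : Prop := forall e, 0 < e ->
  exists P, sine_poly P /\ (qnorm (fun x => f x - P x)%R < e%:E)%E.

Lemma approximable_lim f : mf f ->
  (forall e, 0 < e -> exists g, [/\ mf g, approximable g &
     (qnorm (fun x => f x - g x)%R < e%:E)%E]) -> approximable f.
Proof.
move=> ff H e e0; have e4 : 0 < e / 4 by rewrite divr_gt0.
have [g [gg /(_ _ e4)[P [PP gP]] fg]] := H _ e4; exists P; split => //.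
rewrite (_ : (fun x => _) = fun x => (f x - g x) + (g x - P x)).
  apply: qnormD_lt => //; apply: measurable_funB => //; exact: measurable_sine_poly.
by apply/funext => x; rewrite addrA subrK.
Qed.

Lemma approximable_sine_poly P : sine_poly P -> approximable P.
Proof.
move=> PP e e0; exists P; split => //; rewrite /qnorm integral0_eq ?lte_fin //.
by move=> x _; rewrite subrr expr0n.
Qed.

Lemma approximableD f g : mf f -> mf g -> approximable f -> approximable g ->
  approximable (fun x => f x + g x).
Proof.
move=> ff gg fP gP e e0; have e4 : 0 < e / 4 by rewrite divr_gt0.
have [P [PP fP']] := fP _ e4; have [Q [QQ gQ]] := gP _ e4.
exists (fun x => P x + Q x); split; first exact: sine_polyD.
rewrite (_ : (fun x => _) = fun x => (f x - P x) + (g x - Q x)).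
  apply: qnormD_lt => //; apply: measurable_funB => //; exact: measurable_sine_poly.
by apply/funext => x; ring.
Qed.

Lemma approximableZ (k : R) f : mf f -> approximable f -> approximable (fun x => k * f x).
Proof.
move=> ff fP e e0.
have k0 : 0 < k ^+ 2 + 1 by rewrite ltr_wpDl ?sqr_ge0.
have [|P [PP fP']] := fP (e / (k ^+ 2 + 1)); first by rewrite divr_gt0.
exists (fun x => k * P x); split; first exact: sine_polyZ.
rewrite (_ : (fun x => _) = fun x => k * (f x - P x)); last first.
  by apply/funext => x; rewrite mulrBr.
rewrite qnormZ; last by apply: measurable_funB => //; exact: measurable_sine_poly.
apply: (@le_lt_trans _ _ ((k ^+ 2)%:E * (e / (k ^+ 2 + 1))%:E)%E).
  by rewrite lee_wpmul2l ?lee_fin ?sqr_ge0 // ltW.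
by rewrite -EFinM lte_fin mulrA ltr_pdivrMr // mulrC ltr_pM2l // ltrDl.
Qed.

End SinePolynomials.

(** * Completeness of the sines *)

Section SharpSteps.
Context {R : realType}.
Implicit Types (y u : R) (n m : nat).

(** The second inequality follows from (1 - u)^m (1 + u)^m <= 1; together they
    show that (1 - u)^m is close to 1 when m u is small and close to 0 when
    m u is large. *)
Lemma bernoulli_ineq u m : 0 <= u <= 1 ->
  1 - m%:R * u <= (1 - u) ^+ m /\ (1 - u) ^+ m * (1 + m%:R * u) <= 1.
Proof.
move=> /andP[u0 u1]; elim: m => [|m [IH1 IH2]].
  by rewrite mul0r subr0 addr0 mulr1 expr0.
have p0 : 0 <= (1 - u) ^+ m by rewrite exprn_ge0 // subr_ge0.
have m0 : 0 <= m%:R :> R by [].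
have le : (1 - u) * (1 + (m%:R + 1) * u) <= 1 + m%:R * u.
  have : 0 <= (m%:R + 1) * u ^+ 2 by rewrite mulr_ge0 ?sqr_ge0 // addr_ge0.
  by lra.
rewrite exprS -natr1; split; first by nra.
by have := ler_wpM2l p0 le; lra.
Qed.

Lemma step_to1 y : 0 <= y < 2^-1 ->
  (fun n => (1 - y ^+ n) ^+ (2 ^ n)) @ \oo --> (1 : R).
Proof.
move=> /andP[y0 y1].
apply: (@squeeze_cvgr _ _ _ _ (fun n => 1 - (2 * y) ^+ n) (fun=> 1)).
- apply: nearW => n.
  have yn : 0 <= y ^+ n <= 1 by rewrite exprn_ge0 //= exprn_ile1 //; lra.
  have [le1 _] := bernoulli_ineq (2 ^ n) yn.
  rewrite exprMn -natrX le1 /= exprn_ile1 //; lra.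
- rewrite -[X in _ --> X]subr0; apply: cvgB; first exact: cvg_cst.
  by apply: cvg_expr; rewrite ger0_norm; lra.
- exact: cvg_cst.
Qed.

Lemma step_to0 y : 2^-1 < y <= 1 ->
  (fun n => (1 - y ^+ n) ^+ (2 ^ n)) @ \oo --> (0 : R).
Proof.
move=> /andP[y1 y2]; have y0 : 0 < y by lra.
apply: (@squeeze_cvgr _ _ _ _ (fun=> 0) (fun n => (2 * y)^-1 ^+ n)).
- apply: nearW => n.
  have yn : 0 <= y ^+ n <= 1 by rewrite exprn_ge0 ?exprn_ile1 ?(ltW y0).
  have [_ le1] := bernoulli_ineq (2 ^ n) yn.
  have p0 : 0 <= (1 - y ^+ n) ^+ (2 ^ n) by rewrite exprn_ge0 //; lra.
  have q0 : 0 < (2 * y) ^+ n by rewrite exprn_gt0 // mulr_gt0.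
  rewrite p0 /= exprVn -[leRHS]mul1r ler_pdivlMr // (le_trans _ le1) // ler_wpM2l //.
  by rewrite exprMn -natrX lerDr.
- exact: cvg_cst.
- apply: cvg_expr; rewrite ger0_norm ?invr_ge0 ?mulr_ge0 ?(ltW y0) // invf_lt1; lra.
Qed.

End SharpSteps.

Section Density.
Context {R : realType}.
Local Notation mu := (@lebesgue_measure R).
Local Notation I01 := (`]0%R, 1%R[%classic : set R).
Local Notation mf := (measurable_fun I01).
Implicit Types (f g h P : R -> R) (e t : R) (A : set R).

Definition half_sine (x : R) : R := sin (pi * x).

Lemma sine_poly_half_sine : sine_poly half_sine.
Proof.
have -> : half_sine = fun x => (Num.sqrt 2)^-1 * sine 1%N x.
  apply/funext => x; rewrite /sine mul1r mulrA mulVf ?mul1r // gt_eqF // sqrtr_gt0.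
by apply: sine_polyZ; exact: sine_poly_sine.
Qed.

Lemma measurable_half_sine : mf half_sine.
Proof. exact: measurable_sine_poly sine_poly_half_sine. Qed.

Lemma half_sine_gt0 x : I01 x -> 0 < half_sine x.
Proof.
rewrite /= in_itv /= => /andP[x0 x1]; apply: sin_gt0_pi.
by rewrite mulr_gt0 ?pi_gt0 //= gtr_pMr ?pi_gt0.
Qed.

Lemma half_sine_le1 x : `|half_sine x| <= 1.
Proof. by rewrite ler_norml sin_geN1 sin_le1. Qed.

Lemma eq_approximable f g : (forall x, I01 x -> f x = g x) -> approximable f -> approximable g.
Proof.
move=> fg fP e e0; have [P [PP H]] := fP e e0; exists P; split => //.
by rewrite -(@eq_qnorm _ (fun x => f x - P x)) // => x /set_mem xI; rewrite fg.
Qed.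

Lemma measurable_half_sine_indic A : measurable A -> mf (fun x => half_sine x * \1_A x).
Proof. by move=> mA; apply: measurable_funM; [exact: measurable_half_sine|exact: measurable_indic]. Qed.

Lemma half_sine_indic_le1 A x : `|half_sine x * \1_A x| <= 1.
Proof.
rewrite normrM; have := half_sine_le1 x; rewrite indicE.
by case: (x \in A); rewrite ?normr1 ?mulr1 // normr0 mulr0.
Qed.

Lemma qnorm1_fin : (qnorm (fun=> 1%R : R) < +oo)%E.
Proof.
have -> : qnorm (fun=> 1 : R) = (\int[mu]_(x in I01) cst (1%R)%:E x)%E.
  by apply: eq_integral => x _; rewrite expr1n.
have E : lebesgue_measure I01 = 1%:E :> \bar R.
  by rewrite lebesgue_measure_itv /= lte_fin ltr01 -EFinB subr0.
by rewrite integral_cst // mul1e -[ltLHS]/(lebesgue_measure I01) E ltry.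
Qed.

Lemma ae_neq t (Q : R -> Prop) : (forall x, x != t -> Q x) -> {ae mu, forall x, Q x}.
Proof.
move=> H; exists [set t]; split; [exact: measurable_set1|exact: lebesgue_measure_set1|].
by move=> x /= nQ; apply: contrapT => xt; apply: nQ; apply: H; apply/eqP.
Qed.

(** Sets separated by the level 1/2 of a polynomial y in cos (pi x): the
    polynomials (1 - y^n)^(2^n) tend to 1 where y < 1/2 and to 0 where
    y > 1/2. *)
Lemma approximable_level (q : {poly R}) t A : measurable A ->
  (forall x, I01 x -> 0 <= q.[cos (pi * x)] <= 1) ->
  (forall x, I01 x -> x != t -> A x -> q.[cos (pi * x)] < 2^-1) ->
  (forall x, I01 x -> x != t -> ~ A x -> 2^-1 < q.[cos (pi * x)]) ->
  approximable (fun x => half_sine x * \1_A x).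
Proof.
move=> mA q01 qA qnA.
pose F n x := half_sine x * ((1 - q ^+ n) ^+ (2 ^ n)).[cos (pi * x)].
have FP n : sine_poly (F n) by apply: sine_poly_horner; exact: sine_poly_half_sine.
have FE n x : F n x = half_sine x * (1 - q.[cos (pi * x)] ^+ n) ^+ (2 ^ n).
  by rewrite /F !hornerE.
apply: approximable_lim; first exact: measurable_half_sine_indic.
move=> e e0.
have [n Hn] : exists n, (qnorm (fun x => half_sine x * \1_A x - F n x)%R < e%:E)%E.
  apply: (@qnorm_dominated R F _ (fun=> 1) e) => //.
  - by move=> n; exact: measurable_sine_poly.
  - exact: measurable_half_sine_indic.
  - exact: qnorm1_fin.
  - move=> n x xI; rewrite FE normrM -[leRHS]mulr1 ler_pM // ?half_sine_le1 //.
    have /andP[q0 q1] := q01 x xI.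
    have qn : 0 <= q.[cos (pi * x)] ^+ n <= 1 by rewrite exprn_ge0 //= exprn_ile1.
    by rewrite normrX exprn_ile1 // ger0_norm; lra.
  - by move=> x _; exact: half_sine_indic_le1.
  apply: (@ae_neq t) => x xt xI.
  under eq_fun do rewrite FE.
  apply: cvgMr; have /andP[q0 q1] := q01 x xI; rewrite indicE.
  have [xA|nxA] := pselect (A x).
    by rewrite mem_set //; apply: step_to1; rewrite q0 qA.
  by rewrite memNset //; apply: step_to0; rewrite q1 qnA.
exists (F n); split => //; first exact: measurable_sine_poly.
exact: approximable_sine_poly.
Qed.

Lemma approximable_setC A : measurable A -> approximable (fun x => half_sine x * \1_A x) ->
  approximable (fun x => half_sine x * \1_(~` A) x).
Proof.
move=> mA AA; rewrite (_ : (fun x => _) = fun x => half_sine x + (-1) * (half_sine x * \1_A x)).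
  apply: approximableD; [exact: measurable_half_sine| | |].
  - by apply: measurable_funM => //; exact: measurable_half_sine_indic.
  - by apply: approximable_sine_poly; exact: sine_poly_half_sine.
  - by apply: approximableZ => //; exact: measurable_half_sine_indic.
apply/funext => x; rewrite !indicE in_setC; case: (x \in A) => /=; ring.
Qed.

(** The half-line is cut out, in (0,1), by comparing cos (pi x) with
    c = cos (pi t).  The affine functions used take the value 1/2 at c and stay
    between 0 and 1, which requires a different choice according to the sign
    of c. *)
Lemma approximable_ray t : approximable (fun x => half_sine x * \1_(`]t, +oo[) x).
Proof.
have [t0|t0] := leP t 0.
  apply: eq_approximable (approximable_sine_poly sine_poly_half_sine) => x.
  rewrite /= in_itv /= => /andP[x0 _].
  by rewrite indicE mem_set ?mulr1 //= in_itv /= andbT (le_lt_trans t0).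
have [t1|t1] := leP 1 t.
  apply: eq_approximable (approximable_sine_poly (sine_polyZ 0 sine_poly_half_sine)) => x.
  rewrite /= in_itv /= => /andP[_ x1].
  rewrite indicE memNset ?mulr0 ?mul0r //= in_itv /= andbT; apply/negP.
  by rewrite -leNgt (le_trans (ltW x1)).
have pi0 := pi_gt0 R.
have itv x : I01 x -> pi * x \in `[0, pi]%R.
  rewrite /= !in_itv /= => /andP[x0 x1].
  by rewrite mulr_ge0 ?(ltW pi0) ?(ltW x0) //= ler_piMr ?(ltW x1) ?(ltW pi0).
have tI : I01 t by rewrite /= in_itv /= t0 t1.
have lt_cos x : I01 x -> (cos (pi * x) < cos (pi * t)) = (t < x).
  by move=> xI; rewrite ltr_cos ?itv // ltr_pM2l.
have lt_cos' x : I01 x -> (cos (pi * t) < cos (pi * x)) = (x < t).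
  by move=> xI; rewrite ltr_cos ?itv // ltr_pM2l.
have cle (x : R) : -1 <= cos (pi * x) <= 1 by rewrite cos_geN1 cos_le1.
set c := cos (pi * t) in lt_cos lt_cos'.
have [c0|c0] := leP 0 c.
  have d0 : 0 < (2 * (1 + c))^-1 by rewrite invr_gt0; lra.
  have dE : (2 * (1 + c))^-1 * (1 + c) = 2^-1 by field; lra.
  apply: (@approximable_level ((2 * (1 + c))^-1 *: (1 + 'X)) t) => [|x xI|x xI xt|x xI xt].
  - exact: measurable_itv.
  - rewrite !hornerE; have /andP[c1 c2] := cle x.
    apply/andP; split; nra.
  - rewrite /= in_itv /= andbT -(lt_cos x xI) => lt; rewrite !hornerE; nra.
  - rewrite /= in_itv /= andbT => /negP; rewrite -leNgt => xt'.
    have : x < t by rewrite lt_neqAle xt.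
    by rewrite -(lt_cos' x xI) => lt; rewrite !hornerE; nra.
have -> : `]t, +oo[%classic = ~` `]-oo, t]%classic by rewrite setCitvl.
apply: approximable_setC; first exact: measurable_itv.
have /andP[cN1 _] := cle t; rewrite -/c in cN1.
have d0 : 0 < (2 * (1 - c))^-1 by rewrite invr_gt0; lra.
have dE : (2 * (1 - c))^-1 * (1 - c) = 2^-1 by field; lra.
apply: (@approximable_level ((2 * (1 - c))^-1 *: (1 - 'X)) t) => [|x xI|x xI xt|x xI xt].
- exact: measurable_itv.
- rewrite !hornerE; have /andP[c1 c2] := cle x.
  apply/andP; split; nra.
- rewrite /= in_itv /= => xt'.
  have : x < t by rewrite lt_neqAle xt.
  by rewrite -(lt_cos' x xI) => lt; rewrite !hornerE; nra.
- rewrite /= in_itv /= => /negP; rewrite -ltNge -(lt_cos x xI) => lt.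
  by rewrite !hornerE; nra.
Qed.

End Density.

Import HBNNSimple.

Section Completeness.
Context {R : realType}.
Local Notation mu := (@lebesgue_measure R).
Local Notation I01 := (`]0%R, 1%R[%classic : set R).
Local Notation mf := (measurable_fun I01).
Implicit Types (f g h P : R -> R) (e t : R) (A : set R).

(** Dynkin's theorem, from the half-lines, which generate the Borel sets and are
    stable under intersection. *)
Lemma approximable_indic A : measurable A -> approximable (fun x : R => half_sine x * \1_A x).
Proof.
pose G : set (set R) := @RGenOInfty.G R.
move=> mA; have : <<s G >> A.
  by have := mA; rewrite [measurable](RGenOInfty.measurableE R).
apply: (@dynkin_induction _ (measurableTypeR R) G
  (fun B => approximable (fun x : R => half_sine x * \1_B x))).
- exact: RGenOInfty.measurableE.
- move=> _ _ [s ->] [t ->]; exists (Num.max s t).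
  rewrite predeqE => x; rewrite /= !in_itv /= !andbT gt_max.
  by split => [[-> ->]//|/andP[]].
- apply: eq_approximable (approximable_sine_poly sine_poly_half_sine) => x _.
  by rewrite indicT mulr1.
- by move=> _ [t ->]; exact: approximable_ray.
- by move=> B mB; exact: approximable_setC.
move=> F mF tF FP.
have mU : measurable (\bigcup_k F k) by exact: bigcupT_measurable.
pose S n (x : R) := \sum_(0 <= k < n) half_sine x * \1_(F k) x.
have SP n : mf (S n) /\ approximable (S n).
  elim: n => [|n [IH1 IH2]].
    rewrite (_ : S 0%N = fun x => 0 * half_sine x); last first.
      by apply/funext => x; rewrite /S big_geq // mul0r.
    have PP := sine_polyZ 0 (@sine_poly_half_sine R).
    by split; [exact: measurable_sine_poly|exact: approximable_sine_poly].
  rewrite (_ : S n.+1 = fun x => S n x + half_sine x * \1_(F n) x); last first.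
    by apply/funext => x; rewrite /S big_nat_recr.
  have m1 := measurable_half_sine_indic (mF n).
  by split; [exact: measurable_funD|exact: approximableD].
have SE n x k0 : F k0 x -> S n x = if (k0 < n)%N then half_sine x else 0.
  move=> Fk0; have F0 k : k != k0 -> \1_(F k) x = 0 :> R.
    move=> kk0; rewrite indicE memNset // => Fk; case/eqP: kk0.
    by apply: tF => //; exists x.
  have F1 : \1_(F k0) x = 1 :> R by rewrite indicE mem_set.
  rewrite /S; case: ifPn => k0n.
    rewrite (bigD1_seq k0) ?iota_uniq ?mem_index_iota //= F1 mulr1 big1 ?addr0 // => k.
    by move=> /F0 ->; rewrite mulr0.
  rewrite big_nat big1 // => k /andP[_ kn]; rewrite F0 ?mulr0 //.
  by apply: contraNneq k0n => <-.
have S0 n x : ~ (\bigcup_k F k) x -> S n x = 0.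
  move=> nF; rewrite /S big1 // => k _; rewrite indicE memNset ?mulr0 // => Fk.
  by apply: nF; exists k.
apply: approximable_lim; first exact: measurable_half_sine_indic.
move=> e e0.
have [n Hn] : exists n, (qnorm (fun x => half_sine x * \1_(\bigcup_k F k) x - S n x)%R < e%:E)%E.
  apply: (@qnorm_dominated R S _ (fun=> 1) e) => //.
  - by move=> n; have [] := SP n.
  - exact: measurable_half_sine_indic.
  - exact: qnorm1_fin.
  - move=> n x _; have [[k0 _ Fk0]|nF] := pselect ((\bigcup_k F k) x).
      by rewrite (SE n x k0) //; case: ifP; rewrite ?normr0 ?half_sine_le1.
    by rewrite S0 // normr0.
  - by move=> x _; exact: half_sine_indic_le1.
  apply: aeW => x _; have [Ux|nF] := pselect ((\bigcup_k F k) x); last first.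
    rewrite indicE memNset // mulr0; under eq_fun do rewrite S0 //.
    exact: cvg_cst.
  rewrite indicE mem_set // mulr1; case: Ux => k0 _ Fk0.
  apply: cvg_near_cst; exists k0.+1 => // n /= k0n.
  by rewrite (SE n x k0) // k0n.
by have [SP1 SP2] := SP n; exists (S n).
Qed.

Lemma approximable_sum (I : Type) (r : seq I) (F : I -> R -> R) :
  (forall i, mf (F i) /\ approximable (F i)) ->
  mf (fun x => \sum_(i <- r) F i x) /\ approximable (fun x => \sum_(i <- r) F i x).
Proof.
move=> HF; elim: r => [|i r [IH1 IH2]].
  rewrite (_ : (fun x => _) = fun x => 0 * half_sine x); last first.
    by apply/funext => x; rewrite big_nil mul0r.
  have PP := sine_polyZ 0 (@sine_poly_half_sine R).
  by split; [exact: measurable_sine_poly|exact: approximable_sine_poly].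
rewrite (_ : (fun x => _) = fun x => F i x + \sum_(j <- r) F j x); last first.
  by apply/funext => x; rewrite big_cons.
by have [F1 F2] := HF i; split; [exact: measurable_funD|exact: approximableD].
Qed.

Lemma approximable_nnsfun (h : {nnsfun R >-> R}) :
  mf (fun x => half_sine x * h x) /\ approximable (fun x => half_sine x * h x).
Proof.
rewrite (_ : (fun x => _) = fun x => \sum_(y <- finmap.enum_fset (fset_set (range h)))
    y * (half_sine x * \1_(h @^-1` [set y]) x)); last first.
  apply/funext => x; rewrite {1}fimfunE fsbig_finite //= mulr_sumr.
  by apply: eq_bigr => y _; rewrite mulrCA.
apply: approximable_sum => y.
have mh : measurable (h @^-1` [set y]) by [].
have m1 := measurable_half_sine_indic mh.
split; first by apply: measurable_funM.
by apply: approximableZ => //; exact: approximable_indic.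
Qed.

Lemma measurable_half_sineV : mf (fun x => (half_sine x)^-1).
Proof.
apply: open_continuous_measurable_fun; first exact: interval_open.
move=> x /set_mem xI; apply: cvgV; first by rewrite gt_eqF // half_sine_gt0.
apply: (@continuous_comp _ _ _ (fun x : R => pi * x) sin); last exact: continuous_sin.
exact: mulrl_continuous.
Qed.

(** The quotient of g by sin (pi x) is an increasing limit of simple functions,
    and multiplying back by sin (pi x) keeps the approximations below g. *)
Lemma approximable_ge0 g : mf g -> (qnorm g < +oo)%E -> (forall x, 0 <= g x) ->
  approximable g.
Proof.
move=> gg g2 g0; pose h x := (half_sine x)^-1 * g x.
have mh : measurable_fun I01 (EFin \o h).
  by apply/measurable_EFinP; apply: measurable_funM => //; exact: measurable_half_sineV.
have h0 x : I01 x -> (0 <= (EFin \o h) x)%E.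
  by move=> xI; rewrite lee_fin mulr_ge0 // invr_ge0 ltW // half_sine_gt0.
have gE x : I01 x -> g x = half_sine x * h x.
  by move=> xI; rewrite /h mulrA mulfV ?mul1r // gt_eqF // half_sine_gt0.
pose F n x := half_sine x * nnsfun_approx (@measurable_I01 R) mh n x.
apply: approximable_lim => // e e0.
have [n Hn] : exists n, (qnorm (fun x => g x - F n x)%R < e%:E)%E.
  apply: (@qnorm_dominated R F _ g e) => //.
  - by move=> n; have [] := approximable_nnsfun (nnsfun_approx (@measurable_I01 R) mh n).
  - move=> n x xI; rewrite /F ger0_norm; last by rewrite mulr_ge0 // ltW // half_sine_gt0.
    rewrite (gE x) // ler_wpM2l ?(ltW (half_sine_gt0 xI)) // -lee_fin nnsfun_approxE.
    by apply: le_approx.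
  - by move=> x _; rewrite ger0_norm.
  apply: aeW => x xI; rewrite (gE x) //; apply: cvgMr.
  have /fine_cvgP[_] := cvg_nnsfun_approx (@measurable_I01 R) mh h0 xI.
  exact.
by have [F1 F2] := approximable_nnsfun (nnsfun_approx (@measurable_I01 R) mh n); exists (F n).
Qed.

Theorem sine_polys_dense f : mf f -> (qnorm f < +oo)%E -> approximable f.
Proof.
move=> ff f2.
have part g : mf g -> (forall x, 0 <= g x) -> (forall x, `|g x| <= `|f x|) -> approximable g.
  move=> gg g0 gf; apply: approximable_ge0 => //; apply: le_lt_trans f2.
  by apply: qnorm_le => // x _.
rewrite (_ : f = fun x => f^\+ x + (-1) * f^\- x); last first.
  apply/funext => x; rewrite mulN1r /funrpos /funrneg /Order.max.
  by case: ifPn; case: ifPn; rewrite -?leNgt; lra.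
have mp := measurable_funrpos ff; have mn := measurable_funrneg ff.
apply: approximableD => //; first by apply: measurable_funM.
  apply: part => // x; rewrite /funrpos /Order.max; case: ifPn => //.
  by move=> _; rewrite normr0.
apply: approximableZ => //; apply: part => // x; rewrite /funrneg /Order.max; case: ifPn => // _.
  by rewrite normr0.
by rewrite normrN.
Qed.

End Completeness.

(** * Fourier sine series *)

Section InnerProduct.
Context {R : realType}.
Local Notation mu := (@lebesgue_measure R).
Local Notation I01 := (`]0%R, 1%R[%classic : set R).
Local Notation mf := (measurable_fun I01).
Implicit Types (f g h : R -> R) (k w : R) (n m N : nat).

Definition sq_integrable f : Prop := mf f /\ (qnorm f < +oo)%E.

Definition ip f g : R := \int[mu]_(x in I01) (f x * g x).

Lemma sq_integrable_bounded f K : mf f -> (forall x, `|f x| <= K) -> sq_integrable f.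
Proof.
move=> ff fK; split => //.
apply: (@le_lt_trans _ _ (qnorm (fun x => (K * 1)%R))).
  apply: qnorm_le => // x _; rewrite mulr1.
  by rewrite (le_trans (fK x)) // ler_norm.
by rewrite qnormZ // lte_mul_pinfty ?lee_fin ?sqr_ge0 // qnorm1_fin.
Qed.

Lemma sq_integrableZ k f : sq_integrable f -> sq_integrable (fun x => k * f x).
Proof.
move=> [ff f2]; split; first exact: measurable_funM.
by rewrite qnormZ // lte_mul_pinfty ?lee_fin ?sqr_ge0.
Qed.

Lemma sq_integrableD f g : sq_integrable f -> sq_integrable g ->
  sq_integrable (fun x => f x + g x).
Proof.
move=> [ff f2] [gg g2]; split; first exact: measurable_funD.
apply: (le_lt_trans (qnormD_le ff gg)).
by apply: lte_add_pinfty; rewrite lte_mul_pinfty ?lee_fin.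
Qed.

Lemma integrable_mul f g : sq_integrable f -> sq_integrable g ->
  mu.-integrable I01 (EFin \o (fun x => f x * g x)).
Proof.
move=> [ff f2] [gg g2].
have mfg : measurable_fun I01 (EFin \o (fun x => f x * g x)).
  by apply/measurable_EFinP; exact: measurable_funM.
apply/integrableP; split => //.
apply: (@le_lt_trans _ _ (qnorm f + qnorm g)%E); last exact: lte_add_pinfty.
rewrite /qnorm -ge0_integralD //=; last 4 first.
- by move=> x _; rewrite lee_fin sqr_ge0.
- exact: measurable_EFin_sq.
- by move=> x _; rewrite lee_fin sqr_ge0.
- exact: measurable_EFin_sq.
apply: ge0_le_integral => //=.
- by apply/measurable_EFinP; apply: measurableT_comp => //; exact: measurable_funM.
- by apply: emeasurable_funD; exact: measurable_EFin_sq.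
move=> x _; rewrite lee_fin ler_norml.
have := sqr_ge0 (f x - g x); have := sqr_ge0 (f x + g x).
by move=> h1 h2; apply/andP; split; nra.
Qed.

Lemma ipC f g : ip f g = ip g f.
Proof. by apply: eq_Rintegral => x _; rewrite mulrC. Qed.

Lemma ip_linear k f g h : sq_integrable f -> sq_integrable g -> sq_integrable h ->
  ip (fun x => f x + k * g x) h = ip f h + k * ip g h.
Proof.
move=> f2 g2 h2; rewrite /ip.
rewrite -RintegralZl ?measurable_I01 //; last exact: integrable_mul.
rewrite -RintegralD ?measurable_I01 //.
- by apply: eq_Rintegral => x _; rewrite mulrDl mulrA.
- exact: integrable_mul.
rewrite (_ : _ \o _ = EFin \o (fun x => (k * g x) * h x)).
  by apply: integrable_mul => //; exact: sq_integrableZ.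
by apply/funext => x /=; rewrite mulrA.
Qed.

Lemma qnorm_ip f : sq_integrable f -> qnorm f = (ip f f)%:E.
Proof.
move=> [ff f2]; rewrite /ip /Rintegral fineK.
  by apply: eq_integral => x _; rewrite expr2.
rewrite (_ : integral _ _ _ = qnorm f).
  by rewrite ge0_fin_numE // qnorm_ge0.
by apply: eq_integral => x _; rewrite expr2.
Qed.

Lemma sq_integrable_sine n : sq_integrable (sine n).
Proof.
apply: (@sq_integrable_bounded _ (Num.sqrt 2)); first exact: measurable_sine.
move=> x; rewrite /sine normrM ger0_norm ?sqrtr_ge0 // ler_piMr ?sqrtr_ge0 //.
by rewrite ler_norml sin_geN1 sin_le1.
Qed.

Lemma sin_nat_pi n : sin (n%:R * pi) = 0 :> R.
Proof.
elim: n => [|n IH]; first by rewrite mul0r sin0.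
by rewrite -natr1 mulrDl mul1r sinDpi IH oppr0.
Qed.

Lemma Rintegral_cos w : w != 0 -> \int[mu]_(x in I01) cos (w * x) = sin w / w.
Proof.
move=> w0; rewrite /Rintegral.
have cw : continuous (fun x : R => cos (w * x)).
  move=> x; apply: (@continuous_comp _ _ _ (fun x : R => w * x) cos); last exact: continuous_cos.
  exact: mulrl_continuous.
have cs : continuous (fun x : R => sin (w * x) / w).
  move=> x; apply: cvgMl.
  apply: (@continuous_comp _ _ _ (fun x : R => w * x) sin); last exact: continuous_sin.
  exact: mulrl_continuous.
have dF (x : R) : is_derive x 1 (fun x : R => sin (w * x) / w) (cos (w * x)).
  have -> : (fun x : R => sin (w * x) / w) = (fun x => w^-1 * (sin \o (fun x => w * x)) x).
    by apply/funext => y /=; rewrite mulrC.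
  have H1 : is_derive x 1 (fun x : R => w * x) w.
    have := is_deriveZ w (is_derive_id x (1 : R)); rewrite /GRing.scale /= mulr1.
    by [].
  have H2 : is_derive x 1 (sin \o (fun x : R => w * x)) (w * cos (w * x)).
    by rewrite mulrC; exact: (is_derive1_comp (is_derive_sin (w * x)) H1).
  have := is_deriveZ w^-1 H2; rewrite /GRing.scale /= mulrA mulVf // mul1r.
  by [].
rewrite -(@integral_itv_bndoo _ _ _ _ true false); last first.
  apply/measurable_EFinP; apply: measurable_funTS.
  by apply: continuous_measurable_fun.
rewrite (@continuous_FTC2 _ _ (fun x => sin (w * x) / w)) //.
- by rewrite mulr1 mulr0 sin0 mul0r sube0.
- exact: continuous_subspaceT.
- split.
  + by move=> x _; have [] := dF x.
  + by apply: cvg_at_right_filter; exact: cs.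
  + by apply: cvg_at_left_filter; exact: cs.
- by move=> x _; rewrite derive1E; have [_ ->] := dF x.
Qed.

Lemma sq_integrable_cos w : sq_integrable (fun x : R => cos (w * x)).
Proof.
apply: (@sq_integrable_bounded _ 1); last by move=> x; rewrite ler_norml cos_geN1 cos_le1.
apply: measurable_funTS; apply: continuous_measurable_fun => x.
apply: (@continuous_comp _ _ _ (fun x : R => w * x) cos); last exact: continuous_cos.
exact: mulrl_continuous.
Qed.

Lemma ip_cos1 w : ip (fun x : R => cos (w * x)) (fun=> 1) = \int[mu]_(x in I01) cos (w * x).
Proof. by apply: eq_Rintegral => x _; rewrite mulr1. Qed.

Lemma ip_sine n m : (0 < n)%N -> (0 < m)%N -> ip (sine n) (sine m) = (n == m)%:R.
Proof.
move=> n0 m0; have pi0 : pi != 0 :> R by rewrite gt_eqF // pi_gt0.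
pose u : R := (n%:R - m%:R) * pi; pose v : R := (n%:R + m%:R) * pi.
have one2 : sq_integrable (fun=> 1 : R).
  by apply: (@sq_integrable_bounded _ 1) => // x; rewrite normr1.
have -> : ip (sine n) (sine m) =
    ip (fun x => cos (u * x) + (-1) * cos (v * x)) (fun=> 1).
  apply: eq_Rintegral => x _; rewrite mulr1 /sine.
  have -> : u * x = n%:R * pi * x - m%:R * pi * x by rewrite /u; ring.
  have -> : v * x = n%:R * pi * x + m%:R * pi * x by rewrite /v; ring.
  rewrite cosB cosD mulrACA -expr2 sqr_sqrtr //; ring.
rewrite ip_linear //; try exact: sq_integrable_cos.
rewrite !ip_cos1 (@Rintegral_cos v); last first.
  by rewrite /v mulf_neq0 // -natrD pnatr_eq0 addn_eq0 negb_and -!lt0n n0.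
have -> : sin v = 0 by rewrite /v -natrD sin_nat_pi.
rewrite mul0r mulr0 addr0; case: eqVneq => [nm|nm].
  rewrite (@eq_Rintegral _ _ _ _ _ (fun=> 1)); last first.
    by move=> x _; rewrite /u nm subrr !mul0r cos0.
  rewrite Rintegral_cst // mul1r -[X in fine X]/(lebesgue_measure I01).
  by rewrite lebesgue_measure_itv /= lte_fin ltr01 -EFinB subr0.
rewrite Rintegral_cos; last by rewrite /u mulf_neq0 // subr_eq0 eqr_nat.
by rewrite /u mulrBl sinB !sin_nat_pi mul0r mulr0 subrr mul0r.
Qed.

Definition fourier_coef f n : R := ip f (sine n).

(** By orthonormality; the last sum vanishes exactly at the Fourier
    coefficients, which give the best approximation. *)
Lemma qnorm_sub_sines f (c : nat -> R) N : sq_integrable f ->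
  sq_integrable (fun x => f x - \sum_(1 <= n < N.+1) c n * sine n x) /\
  qnorm (fun x => f x - \sum_(1 <= n < N.+1) c n * sine n x) =
  (ip f f - \sum_(1 <= n < N.+1) fourier_coef f n ^+ 2 +
   \sum_(1 <= n < N.+1) (fourier_coef f n - c n) ^+ 2)%:E.
Proof.
move=> f2.
pose r N x := f x - \sum_(1 <= n < N.+1) c n * sine n x.
suff : sq_integrable (r N) /\ ip (r N) (r N) =
     (ip f f - \sum_(1 <= n < N.+1) fourier_coef f n ^+ 2 +
   \sum_(1 <= n < N.+1) (fourier_coef f n - c n) ^+ 2).
  by move=> [r2 rE]; split => //; rewrite -/(r N) qnorm_ip // rE.
have rS M : r M.+1 = fun x => r M x + (- c M.+1) * sine M.+1 x.
  by apply/funext => x; rewrite /r big_nat_recr //= opprD addrA mulNr.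
have r_sq M : sq_integrable (r M).
  elim: M => [|M IH].
    by rewrite (_ : r 0%N = f) //; apply/funext => x; rewrite /r big_geq // subr0.
  by rewrite rS; apply: sq_integrableD => //; apply: sq_integrableZ; exact: sq_integrable_sine.
have r_ip M (k : nat) : (M < k)%N -> ip (r M) (sine k) = fourier_coef f k.
  elim: M => [|M IH] Mk.
    by rewrite (_ : r 0%N = f) //; apply/funext => x; rewrite /r big_geq // subr0.
  rewrite rS ip_linear ?IH ?(ltnW Mk) //; try exact: sq_integrable_sine.
  by rewrite ip_sine ?ltn_eqF ?mulr0 ?addr0 // (leq_trans _ Mk).
split => //; elim: N => [|N IH].
  rewrite !big_geq // subr0 addr0 (_ : r 0%N = f) //.
  by apply/funext => x; rewrite /r big_geq // subr0.
have s2 := sq_integrable_sine N.+1.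
have s2Z := sq_integrableZ (- c N.+1) s2.
rewrite rS ip_linear //; last by apply: sq_integrableD.
rewrite ipC ip_linear // [X in _ + _ * X]ipC ip_linear // IH.
rewrite [ip (sine _) (r _)]ipC r_ip // ip_sine // eqxx (big_nat_recr N.+1) //= (big_nat_recr N.+1) //=.
by ring.
Qed.

End InnerProduct.

(** * Dilation of even functions of period 2 *)

Lemma periodic_nat (R : realType) (T : Type) (f : R -> T) (k : nat) (x : R) :
  (forall x, f (x + 2) = f x) -> f (x + (2 * k)%:R) = f x.
Proof.
move=> per; elim: k => [|k IH]; first by rewrite muln0 addr0.
by rewrite mulnS addnC natrD addrA per.
Qed.

Section Dilation.
Context {R : realType}.
Local Notation mu := (@lebesgue_measure R).
Local Notation I01 := (`]0%R, 1%R[%classic : set R).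
Implicit Types (a b : R) (D : set R) (G : R -> \bar R).

Definition affine a b (x : measurableTypeR R) : measurableTypeR R := (a * (x : R) + b : R).

Lemma measurable_affine a b : measurable_fun setT (affine a b).
Proof. by apply: measurable_funD => //; exact: measurable_funM. Qed.

(** Packaged as a measure so that the uniqueness of Lebesgue measure applies. *)
Definition affine_image a b : {measure set (measurableTypeR R) -> \bar R}.
Proof.
refine [the {measure set (measurableTypeR R) -> \bar R} of pushforward mu (affine a b)].
exact: measurable_affine.
Defined.

Lemma lebesgue_measure_affine a b (a0 : 0 < a) D : measurable D ->
  mscale (NngNum (ltW a0)) (affine_image a b) D = mu D.
Proof.
move=> mD; apply/esym/lebesgue_measure_unique => //=.
move=> _ [[s t] _ <-]; rewrite /mscale /= /pushforward /=.
have -> : affine a b @^-1` `]s, t] = `](s - b) / a, (t - b) / a]%classic.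
  rewrite predeqE => x; rewrite /= !in_itv /= /affine ltr_pdivrMr // ler_pdivlMr //.
  by rewrite ltrBlDr lerBrDr mulrC.
rewrite !lebesgue_measure_itv /= !lte_fin ltr_pM2r ?invr_gt0 // ltrD2r.
case: ifP => _; last by rewrite mule0.
by rewrite -!EFinB -EFinM; congr EFin; field; rewrite gt_eqF.
Qed.

Lemma ge0_integral_affine a b D G : 0 < a -> measurable D ->
  measurable_fun setT G -> (forall x, (0 <= G x)%E) ->
  (a%:E * \int[mu]_(x in affine a b @^-1` D) G (affine a b x))%E = (\int[mu]_(x in D) G x)%E.
Proof.
move=> a0 mD mG G0; have mGD : measurable_fun (D : set (measurableTypeR R)) (G : measurableTypeR R -> \bar R).
  exact: measurable_funTS.
have <- := @ge0_integral_pushforward _ _ _ _ _ _ (measurable_affine a b) mu D G mD mGD (fun x _ => G0 x).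
rewrite -[X in (_ * X)%E]/(\int[affine_image a b]_(x in D) G x)%E.
rewrite -(@ge0_integral_mscale _ _ _ (affine_image a b) D mD (NngNum (ltW a0)) G mGD) //.
apply: eq_measure_integral => A mA _.
exact: lebesgue_measure_affine.
Qed.

Lemma ge0_integral_opp D G : measurable D ->
  measurable_fun setT G -> (forall x, (0 <= G x)%E) ->
  (\int[mu]_(x in (-%R : R -> R) @^-1` D) G (- x)%R = \int[mu]_(x in D) G x)%E.
Proof.
move=> mD mG G0.
have mN : measurable_fun setT (-%R : measurableTypeR R -> measurableTypeR R).
  exact: oppr_measurable.
have mGD : measurable_fun (D : set (measurableTypeR R)) (G : measurableTypeR R -> \bar R).
  exact: measurable_funTS.
have <- := @ge0_integral_pushforward _ _ _ _ _ _ mN mu D G mD mGD (fun x _ => G0 x).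
by apply: eq_measure_integral => A mA _; exact: lebesgue_measureN.
Qed.

(** Since G is even and has period 2, its integral over every ]k, k+1[ is the
    same, and x |-> n x spreads ]0, 1[ over n such intervals. *)
Lemma ge0_integral_dilate (n : nat) G : (0 < n)%N ->
  measurable_fun setT G -> (forall x, (0 <= G x)%E) ->
  (forall x, G (- x) = G x) -> (forall x, G (x + 2) = G x) ->
  (\int[mu]_(x in I01) G (n%:R * x)%R = \int[mu]_(x in I01) G x)%E.
Proof.
move=> n0 mG G0 Gopp Gper.
have translate (k : R) : (\int[mu]_(x in I01) G (x + k)%R =
    \int[mu]_(x in `]k, (k + 1)%R[) G x)%E.
  have m1 : measurable (`]k, (k + 1)[%classic : set R) by exact: measurable_itv.
  rewrite -(ge0_integral_affine k ltr01 m1 mG G0) mul1e.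
  rewrite (_ : affine 1 k @^-1` _ = I01); last first.
    rewrite predeqE => x; rewrite /= !in_itv /= /affine mul1r.
    by rewrite ltrDr [k + 1]addrC ltrD2r.
  by apply: eq_integral => x _; rewrite /affine mul1r.
have odd1 : (\int[mu]_(x in I01) G (x + 1)%R = \int[mu]_(x in I01) G x)%E.
  transitivity (\int[mu]_(x in I01) G (x + (-1))%R)%E.
    by apply: eq_integral => x _; rewrite -[RHS]Gper; congr G; ring.
  rewrite translate.
  have m1 : measurable (`](-1), (-1 + 1)[%classic : set R) by exact: measurable_itv.
  rewrite -(ge0_integral_opp m1 mG G0) (_ : _ @^-1` _ = I01); last first.
    rewrite predeqE => x; rewrite /= !in_itv /=.
    by split => /andP[h1 h2]; apply/andP; split; lra.
  by apply: eq_integral => x _; rewrite Gopp.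
have unit_int (k : nat) : (\int[mu]_(x in `]k%:R, k.+1%:R]) G x = \int[mu]_(x in I01) G x)%E.
  rewrite integral_itv_bndoo; last exact: measurable_funTS.
  rewrite -natr1 -translate -(odd_double_half k); case: (odd k).
    rewrite -odd1; apply: eq_integral => x _.
    by rewrite natrD addrA -mul2n periodic_nat.
  by apply: eq_integral => x _; rewrite add0n -mul2n periodic_nat.
have sum_int (m : nat) : (\int[mu]_(x in `]0%R, m%:R]) G x =
    m%:R%:E * \int[mu]_(x in I01) G x)%E.
  elim: m => [|m IH].
    by rewrite mul0e (_ : [set` _] = set0) ?integral_set0 // set_itvE.
  have -> : `]0%R, m.+1%:R]%classic = `]0%R, m%:R]%classic `|` `]m%:R, m.+1%:R]%classic :> set R.
    by rewrite -itv_bndbnd_setU // bnd_simp ?ler_nat.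
  rewrite ge0_integral_setU //=.
  - by rewrite IH unit_int -natr1 EFinD ge0_muleDl ?mul1e // ?lee_fin.
  - exact: measurable_funTS.
  - apply/disj_setPS => x [] /=; rewrite !in_itv /= => /andP[_ x1] /andP[x2 _].
    by move: (le_lt_trans x1 x2); rewrite ltxx.
have n0R : 0 < n%:R :> R by rewrite ltr0n.
have mn : measurable (`]0, n%:R[%classic : set R) by exact: measurable_itv.
have := ge0_integral_affine 0 n0R mn mG G0.
rewrite (_ : affine n%:R 0 @^-1` _ = I01); last first.
  rewrite predeqE => x; rewrite /= !in_itv /= /affine addr0.
  by rewrite pmulr_rgt0 // gtr_pMr.
rewrite -(@integral_itv_bndoo _ _ _ G false false); last exact: measurable_funTS.
rewrite sum_int => /(congr1 (fun y => (n%:R^-1)%:E * y)%E).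
rewrite !muleA -!EFinM mulVf ?gt_eqF // !mul1e => <-.
by apply: eq_integral => x _; rewrite /affine addr0.
Qed.

End Dilation.

(** * Odd functions of period 2; complex-valued functions *)

Section OddPeriodic.
Context {R : realType}.
Local Notation I01 := (`]0%R, 1%R[%classic : set R).
Implicit Types (f : R -> R).

Lemma measurable_fun_shift f (s t k : R) :
  (forall x, f (x + k) = f x) -> measurable_fun (`]s, t]%classic : set R) f ->
  measurable_fun (`](s + k), (t + k)]%classic : set R) f.
Proof.
move=> per ff; rewrite (_ : f = f \o (fun x => x - k)); last first.
  by apply/funext => x /=; rewrite -[RHS]per subrK.
apply: measurable_comp ff _ => //.
  move=> _ [x + <-]; rewrite /= !in_itv /= => /andP[h1 h2].
  by apply/andP; split; lra.
by apply: measurable_funB.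
Qed.

(** The values on (0,1) determine f on ]-1, 1], up to the points 0 and 1, by
    oddness, and then on each larger interval ]-(2k+1), 2k+1] by translation. *)
Lemma measurable_odd_periodic f : measurable_fun I01 f ->
  (forall x, f (- x) = - f x) -> (forall x, f (x + 2) = f x) ->
  measurable_fun setT f.
Proof.
move=> ff fodd per.
have f_neg : measurable_fun (`](-1), 0[%classic : set R) f.
  rewrite (_ : f = (-%R) \o (f \o -%R)); last by apply/funext => x /=; rewrite fodd opprK.
  apply: measurableT_comp => //; apply: measurable_comp ff _ => //.
  move=> _ [x + <-]; rewrite /= !in_itv /= => /andP[h1 h2].
  by apply/andP; split; lra.
have f0 : measurable_fun (`](-1), 1]%classic : set R) f.
  have -> : `](-1), 1]%classic =
      `](-1), 0[%classic `|` [set 0] `|` (`]0, 1[%classic `|` [set 1]) :> set R.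
    rewrite predeqE => x; rewrite /= !in_itv /=; split => [/andP[h1 h2]|].
      have [x0|x0|->] := ltgtP x 0; [left; left|right|left; right] => //.
        by apply/andP.
      by move: h2; rewrite le_eqVlt => /orP[/eqP ->|x1]; [right|left; apply/andP].
    by move=> [[/andP[h1 h2]|->]|[/andP[h1 h2]|->]]; apply/andP; split; lra.
  apply/measurable_funU; [by apply: measurableU|by apply: measurableU|split].
    apply/measurable_funU => //; split => //; exact: measurable_fun_set1.
  apply/measurable_funU => //; split => //; exact: measurable_fun_set1.
have fB (k : nat) : measurable_fun (`](- (2 * k).+1%:R), (2 * k).+1%:R]%classic : set R) f.
  elim: k => [|k IH]; first by rewrite muln0.
  have pos := measurable_fun_shift (fun x => periodic_nat k.+1 x per) f0.
  have negper (x : R) : f (x + - (2 * k.+1)%:R) = f x.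
    by rewrite -[LHS](periodic_nat k.+1 _ per) subrK.
  have neg := measurable_fun_shift negper f0.
  have -> : `](- (2 * k.+1).+1%:R), (2 * k.+1).+1%:R]%classic =
    `](-1 + - (2 * k.+1)%:R), (1 + - (2 * k.+1)%:R)]%classic `|`
    (`](- (2 * k).+1%:R), (2 * k).+1%:R]%classic `|`
     `](-1 + (2 * k.+1)%:R), (1 + (2 * k.+1)%:R)]%classic) :> set R.
    have E1 : (2 * k.+1).+1%:R = 2 * k%:R + 3 :> R.
      by rewrite -natr1 natrM -natr1; ring.
    have E2 : (2 * k.+1)%:R = 2 * k%:R + 2 :> R by rewrite natrM -natr1; ring.
    have E3 : (2 * k).+1%:R = 2 * k%:R + 1 :> R by rewrite -natr1 natrM.
    have k0 : 0 <= k%:R :> R by [].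
    rewrite E1 E2 E3; set y : R := k%:R in k0 *.
    rewrite predeqE => x; rewrite /= !in_itv /=; split => [/andP[h1 h2]|].
      have [x1|x1] := leP x (1 - (2 * y + 2)); first by left; apply/andP; split; lra.
      right; have [x2|x2] := leP x (2 * y + 1); first by left; apply/andP; split; lra.
      by right; apply/andP; split; lra.
    by move=> [/andP[h1 h2]|[/andP[h1 h2]|/andP[h1 h2]]]; apply/andP; split; lra.
  apply/measurable_funU => //; [by apply: measurableU|split => //].
  by apply/measurable_funU => //; split.
have -> : setT = \bigcup_k `](- (2 * k).+1%:R), (2 * k).+1%:R]%classic :> set R.
  rewrite predeqE => x; split => // _; exists (Num.truncn `|x|).+1 => //=.
  rewrite in_itv /=.
  have := truncnS_gt `|x|; set k := (Num.truncn _).+1 => xk.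
  have : k%:R <= (2 * k).+1%:R :> R by rewrite ler_nat; lia.
  have := ler_norm x; have := ler_norm (- x); rewrite normrN.
  by move=> h1 h2 h3; apply/andP; split; lra.
by apply/measurable_fun_bigcup => k //; exact: fB.
Qed.

End OddPeriodic.

Section ComplexNorm.
Context {R : realType}.
Local Notation mu := (@lebesgue_measure R).
Local Notation I01 := (`]0%R, 1%R[%classic : set R).
Implicit Types (f g : R -> R[i]) (z : R[i]).

Definition cmeasurable (D : set R) f : Prop :=
  measurable_fun D (fun x => complex.Re (f x)) /\ measurable_fun D (fun x => complex.Im (f x)).

Definition cqnorm f : \bar R := (\int[mu]_(x in I01) (sqn (f x))%:E)%E.

Lemma cqnorm_ge0 f : (0 <= cqnorm f)%E.
Proof. by apply: integral_ge0 => x _; rewrite lee_fin sqn_ge0. Qed.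

Lemma measurable_sqn D f : cmeasurable D f -> measurable_fun D (fun x => (sqn (f x))%:E).
Proof.
move=> [f1 f2]; apply/measurable_EFinP.
rewrite (_ : (fun x => _) = fun x => complex.Re (f x) ^+ 2 + complex.Im (f x) ^+ 2).
  by apply: measurable_funD; exact: measurable_funX.
by apply/funext => x; rewrite sqnE.
Qed.

Lemma cmeasurableZ D z f : cmeasurable D f -> cmeasurable D (fun x => z * f x).
Proof.
move=> [f1 f2]; split.
  rewrite (_ : (fun x => _) = fun x => complex.Re z * complex.Re (f x) - complex.Im z * complex.Im (f x)).
    by apply: measurable_funB; exact: measurable_funM.
  by apply/funext => x; case: z (f x) => [p q] [r s].
rewrite (_ : (fun x => _) = fun x => complex.Re z * complex.Im (f x) + complex.Im z * complex.Re (f x)).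
  by apply: measurable_funD; exact: measurable_funM.
by apply/funext => x; case: z (f x) => [p q] [r s].
Qed.

Lemma cmeasurableD D f g : cmeasurable D f -> cmeasurable D g ->
  cmeasurable D (fun x => f x + g x).
Proof.
move=> [f1 f2] [g1 g2]; split.
  rewrite (_ : (fun x => _) = fun x => complex.Re (f x) + complex.Re (g x)).
    exact: measurable_funD.
  by apply/funext => x; case: (f x) (g x) => [p q] [r s].
rewrite (_ : (fun x => _) = fun x => complex.Im (f x) + complex.Im (g x)).
  exact: measurable_funD.
by apply/funext => x; case: (f x) (g x) => [p q] [r s].
Qed.

Lemma cmeasurable0 D : cmeasurable D (fun=> 0).
Proof. by split; exact: measurable_cst. Qed.

Lemma cmeasurableN D f : cmeasurable D f -> cmeasurable D (fun x => - f x).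
Proof.
move=> ff; rewrite (_ : (fun x => _) = fun x => -1 * f x); first exact: cmeasurableZ.
by apply/funext => x; rewrite mulN1r.
Qed.

Lemma cmeasurableB D f g : cmeasurable D f -> cmeasurable D g ->
  cmeasurable D (fun x => f x - g x).
Proof. by move=> ff gg; apply: cmeasurableD => //; exact: cmeasurableN. Qed.

Lemma cmeasurable_sum D (I : Type) (r : seq I) (F : I -> R -> R[i]) :
  (forall i, cmeasurable D (F i)) -> cmeasurable D (fun x => \sum_(i <- r) F i x).
Proof.
move=> FF; elim: r => [|i r IH].
  by rewrite (_ : (fun x => _) = fun=> 0); [exact: cmeasurable0|apply/funext => x; rewrite big_nil].
rewrite (_ : (fun x => _) = fun x => F i x + \sum_(j <- r) F j x); first exact: cmeasurableD.
by apply/funext => x; rewrite big_cons.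
Qed.

Lemma cmeasurable_real D (f : R -> R) : measurable_fun D f -> cmeasurable D (fun x => (f x)%:C).
Proof. by move=> ff; split => //; exact: measurable_cst. Qed.

Lemma cqnormZ z f : cmeasurable I01 f -> cqnorm (fun x => z * f x) = ((sqn z)%:E * cqnorm f)%E.
Proof.
move=> ff; rewrite /cqnorm -ge0_integralZl //=.
- by apply: eq_integral => x _; rewrite -EFinM sqnM.
- exact: measurable_sqn.
- by move=> x _; rewrite lee_fin sqn_ge0.
- by rewrite lee_fin sqn_ge0.
Qed.

Lemma cqnorm_sum_le (I : Type) (r : seq I) (F : I -> R -> R[i]) :
  (forall i, cmeasurable I01 (F i)) ->
  (cqnorm (fun x => (\sum_(i <- r) F i x)%R) <= (size r)%:R%:E * \sum_(i <- r) cqnorm (F i))%E.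
Proof.
move=> FF.
rewrite /cqnorm -ge0_integral_sum //; last 2 first.
- by move=> i; exact: measurable_sqn.
- by move=> i x _; rewrite lee_fin sqn_ge0.
have ms : measurable_fun I01 (fun x => (\sum_(i <- r) (sqn (F i x))%:E)%E).
  by apply: emeasurable_sum => i; exact: measurable_sqn.
rewrite -ge0_integralZl //; last first.
  by move=> x _; apply: sume_ge0 => i _; rewrite lee_fin sqn_ge0.
apply: ge0_le_integral => //.
- by move=> x _; rewrite lee_fin sqn_ge0.
- by apply: measurable_sqn; exact: cmeasurable_sum.
- by apply: measurable_funeM.
by move=> x _; rewrite sumEFin -EFinM lee_fin; exact: sqn_sum_le.
Qed.

Lemma cqnormD_le f g : cmeasurable I01 f -> cmeasurable I01 g ->
  (cqnorm (fun x => (f x + g x)%R) <= 2%:E * cqnorm f + 2%:E * cqnorm g)%E.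
Proof.
move=> ff gg; pose F (b : bool) := if b then f else g.
have FF b : cmeasurable I01 (F b) by case: b.
have := cqnorm_sum_le [:: true; false] FF.
rewrite !big_cons big_nil adde0 /= muleDr ?ge0_adde_def ?inE ?cqnorm_ge0 //.
rewrite (_ : (fun x => _) = fun x => f x + g x) //.
by apply/funext => x; rewrite !big_cons big_nil addr0.
Qed.

Lemma cqnormD_lt f g (e : R) : cmeasurable I01 f -> cmeasurable I01 g ->
  (cqnorm f < (e / 4)%:E)%E -> (cqnorm g < (e / 4)%:E)%E ->
  (cqnorm (fun x => (f x + g x)%R) < e%:E)%E.
Proof.
move=> ff gg fe ge; apply: (le_lt_trans (cqnormD_le ff gg)).
have -> : e%:E = (2%:E * (e / 4)%:E + 2%:E * (e / 4)%:E)%E.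
  by rewrite -!EFinM -EFinD; congr EFin; field.
apply: lteD; rewrite lte_pmul2l //.
Qed.

Lemma cqnorm_ReIm f : cmeasurable I01 f ->
  cqnorm f = (qnorm (fun x => complex.Re (f x)) + qnorm (fun x => complex.Im (f x)))%E.
Proof.
move=> [f1 f2]; rewrite /qnorm -ge0_integralD //=.
- by apply: eq_integral => x _; rewrite sqnE EFinD.
- by move=> x _; rewrite lee_fin sqr_ge0.
- exact: measurable_EFin_sq.
- by move=> x _; rewrite lee_fin sqr_ge0.
- exact: measurable_EFin_sq.
Qed.

Lemma cqnorm_real (f : R -> R) : cqnorm (fun x => (f x)%:C) = qnorm f.
Proof. by apply: eq_integral => x _; rewrite sqn_real. Qed.

Lemma L2_normE f : L2_norm f = (cqnorm f `^ 2^-1)%E.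
Proof. by []. Qed.

Lemma L2_norm_lt f (e : R) : 0 < e -> (cqnorm f < (e ^+ 2)%:E)%E -> (L2_norm f < e%:E)%E.
Proof.
move=> e0; rewrite L2_normE; have := cqnorm_ge0 f; case: (cqnorm f) => [d| |] //.
rewrite lee_fin lte_fin => d0 de; rewrite poweR_EFin lte_fin powR12_sqrt //.
have E : Num.sqrt (e ^+ 2) = e by rewrite sqrtr_sqr gtr0_norm.
by rewrite -E ltr_sqrt // exprn_gt0.
Qed.

Lemma in_L2_cqnorm f : in_L2 f -> cmeasurable I01 f /\ (cqnorm f < +oo)%E.
Proof.
move=> [f1 f2]; rewrite L2_normE => /lty_poweRy => H; split => //; apply: H.
by rewrite invr_eq0.
Qed.

End ComplexNorm.

(** * The closed span of the dilates *)

Section FourierSeries.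
Context {R : realType}.
Local Notation I01 := (`]0%R, 1%R[%classic : set R).
Implicit Types (f g : R -> R).

(** The partial sums of the Fourier series are at least as close to f as any
    combination of the same sines. *)
Lemma fourier_converges f (e : R) : sq_integrable f -> 0 < e ->
  exists N, forall L, (N <= L)%N ->
    (qnorm (fun x => (f x - \sum_(1 <= n < L.+1) fourier_coef f n * sine n x)%R) < e%:E)%E.
Proof.
move=> f2 e0; have [P [[N [c PE]] fP]] := sine_polys_dense f2.1 f2.2 e0.
exists N => L NL.
have [_ EL] := qnorm_sub_sines (fourier_coef f) L f2.
rewrite EL [X in _ + X]big1 ?addr0; last by move=> n _; rewrite subrr expr0n.
have [_ EN] := qnorm_sub_sines c N f2.
rewrite (_ : P = fun x => \sum_(1 <= n < N.+1) c n * sine n x) in fP; last exact/funext.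
move: fP; rewrite EN !lte_fin; apply: le_lt_trans.
have : \sum_(1 <= n < N.+1) fourier_coef f n ^+ 2 <= \sum_(1 <= n < L.+1) fourier_coef f n ^+ 2.
  by apply: ler_sum_nat_wide => // n; exact: sqr_ge0.
have : 0 <= \sum_(1 <= n < N.+1) (fourier_coef f n - c n) ^+ 2.
  by apply: sumr_ge0 => *; exact: sqr_ge0.
lra.
Qed.

Lemma qnorm_sum_sine (c : nat -> R) N :
  qnorm (fun x => \sum_(1 <= n < N.+1) c n * sine n x) = (\sum_(1 <= n < N.+1) c n ^+ 2)%:E.
Proof.
have z2 : sq_integrable (fun=> 0 : R).
  by apply: (@sq_integrable_bounded _ _ 0) => // x; rewrite normr0.
have [_] := qnorm_sub_sines (fun n => - c n) N z2.
have ip0 h : ip (fun=> 0) h = 0 :> R.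
  rewrite /ip (@eq_Rintegral _ _ _ _ _ (fun=> 0)); last by move=> x _; rewrite mul0r.
  by rewrite /Rintegral integral0.
rewrite /fourier_coef ip0 [X in 0 - X]big1 ?subrr ?add0r; last by move=> n _; rewrite ip0 expr0n.
rewrite (_ : (fun x => _) = fun x => \sum_(1 <= n < N.+1) c n * sine n x); last first.
  by apply/funext => x; rewrite sub0r -sumrN; apply: eq_bigr => n _; rewrite mulNr opprK.
by move=> ->; congr EFin; apply: eq_bigr => n _; rewrite ip0 sub0r opprK.
Qed.

End FourierSeries.

Section ComplexFourier.
Context {R : realType}.
Local Notation I01 := (`]0%R, 1%R[%classic : set R).
Implicit Types (f g phi : R -> R[i]) (c : nat -> R[i]).

Definition csine (n : nat) (x : R) : R[i] := (sine n x)%:C.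

Lemma cmeasurable_csine n D : cmeasurable D (csine n).
Proof. by apply: cmeasurable_real; exact: measurable_sine. Qed.

Lemma cmeasurable_sum_csine c N D :
  cmeasurable D (fun x => \sum_(1 <= n < N.+1) c n * csine n x).
Proof. by apply: cmeasurable_sum => n; apply: cmeasurableZ; exact: cmeasurable_csine. Qed.

Lemma Re_mulr_real (z : R[i]) (x : R) : complex.Re (z * x%:C) = complex.Re z * x.
Proof. by case: z => p q /=; rewrite mulr0 subr0. Qed.

Lemma Im_mulr_real (z : R[i]) (x : R) : complex.Im (z * x%:C) = complex.Im z * x.
Proof. by case: z => p q /=; rewrite mulr0 add0r. Qed.

Lemma Re_sum_csine c N x : complex.Re (\sum_(1 <= n < N.+1) c n * csine n x) =
  \sum_(1 <= n < N.+1) complex.Re (c n) * sine n x.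
Proof. by rewrite raddf_sum /=; apply: eq_bigr => n _; rewrite Re_mulr_real. Qed.

Lemma Im_sum_csine c N x : complex.Im (\sum_(1 <= n < N.+1) c n * csine n x) =
  \sum_(1 <= n < N.+1) complex.Im (c n) * sine n x.
Proof. by rewrite raddf_sum /=; apply: eq_bigr => n _; rewrite Im_mulr_real. Qed.

Lemma cqnorm_sum_csine c N :
  cqnorm (fun x => \sum_(1 <= n < N.+1) c n * csine n x) = (nsq N c)%:E.
Proof.
rewrite cqnorm_ReIm; last exact: cmeasurable_sum_csine.
under [X in qnorm X]eq_fun do rewrite Re_sum_csine.
under [X in (_ + qnorm X)%E]eq_fun do rewrite Im_sum_csine.
rewrite !qnorm_sum_sine -EFinD -big_split; congr EFin.
by apply: eq_bigr => n _; rewrite sqnE.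
Qed.

Lemma cfourier_converges phi (e : R) : cmeasurable I01 phi -> (cqnorm phi < +oo)%E -> 0 < e ->
  exists N, forall L, (N <= L)%N ->
    (cqnorm (fun x => (phi x - \sum_(1 <= n < L.+1) sine_coef phi n * csine n x)%R) < e%:E)%E.
Proof.
move=> mphi phi2 e0; have [m1 m2] := mphi; have e2 : 0 < e / 2 by rewrite divr_gt0.
rewrite cqnorm_ReIm // in phi2.
have f1 : sq_integrable (fun x => complex.Re (phi x)).
  split => //; apply: le_lt_trans phi2; rewrite leeDl // qnorm_ge0 //.
have f2 : sq_integrable (fun x => complex.Im (phi x)).
  split => //; apply: le_lt_trans phi2; rewrite leeDr // qnorm_ge0 //.
have [N1 H1] := fourier_converges f1 e2; have [N2 H2] := fourier_converges f2 e2.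
exists (maxn N1 N2) => L; rewrite geq_max => /andP[/H1 {}H1 /H2 {}H2].
rewrite cqnorm_ReIm; last by apply: cmeasurableB => //; exact: cmeasurable_sum_csine.
rewrite (splitr e) EFinD; apply: lteD.
  rewrite (_ : (fun x => _) = fun x => complex.Re (phi x) -
    \sum_(1 <= n < L.+1) fourier_coef (fun x => complex.Re (phi x)) n * sine n x) //.
  by apply/funext => x; rewrite raddfB /= Re_sum_csine.
rewrite (_ : (fun x => _) = fun x => complex.Im (phi x) -
    \sum_(1 <= n < L.+1) fourier_coef (fun x => complex.Im (phi x)) n * sine n x) //.
by apply/funext => x; rewrite raddfB /= Im_sum_csine.
Qed.

End ComplexFourier.

Section Spanned.
Context {R : realType}.
Local Notation I01 := (`]0%R, 1%R[%classic : set R).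
Variable phi : R -> R[i].
Implicit Types (f g : R -> R[i]) (c : nat -> R[i]).

(** Membership in the closed linear span of the dilates of phi. *)
Definition spanned f : Prop := forall e : R, 0 < e -> exists N c,
  (cqnorm (fun x => (f x - \sum_(1 <= n < N.+1) c n * dilate phi n x)%R) < e%:E)%E.

Hypothesis phi_dil : forall n, cmeasurable I01 (dilate phi n).

Let msum c N : cmeasurable I01 (fun x => \sum_(1 <= n < N.+1) c n * dilate phi n x).
Proof. by apply: cmeasurable_sum => n; exact: cmeasurableZ. Qed.

Lemma spannedZ (z : R[i]) f : cmeasurable I01 f -> spanned f -> spanned (fun x => z * f x).
Proof.
move=> ff fS e e0.
have k0 : 0 < sqn z + 1 by rewrite ltr_wpDl ?sqn_ge0.
have [|N [c H]] := fS (e / (sqn z + 1)); first by rewrite divr_gt0.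
exists N, (fun n => z * c n).
rewrite (_ : (fun x => _) = fun x => z * (f x - \sum_(1 <= n < N.+1) c n * dilate phi n x)); last first.
  by apply/funext => x; rewrite mulrBr mulr_sumr; congr (_ - _); apply: eq_bigr => n _; rewrite mulrA.
rewrite cqnormZ; last exact: cmeasurableB.
apply: (@le_lt_trans _ _ ((sqn z)%:E * (e / (sqn z + 1))%:E)%E).
  by rewrite lee_wpmul2l ?lee_fin ?sqn_ge0 // ltW.
by rewrite -EFinM lte_fin mulrA ltr_pdivrMr // mulrC ltr_pM2l // ltrDl.
Qed.

Lemma spannedD f g : cmeasurable I01 f -> cmeasurable I01 g -> spanned f -> spanned g ->
  spanned (fun x => f x + g x).
Proof.
move=> ff gg fS gS e e0; have e4 : 0 < e / 4 by rewrite divr_gt0.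
have [N [c Hc]] := fS _ e4; have [M [d Hd]] := gS _ e4.
have wide (K L : nat) (u : nat -> R[i]) x : (K <= L)%N ->
    \sum_(1 <= n < K.+1) u n * dilate phi n x =
    \sum_(1 <= n < L.+1) trunc K u n * dilate phi n x.
  move=> KL; rewrite (@big_nat_widen _ _ _ 1 K.+1 L.+1) //= big_mkcond /=.
  by apply: eq_bigr => n _; rewrite /trunc ltnS; case: ifP => // _; rewrite mul0r.
exists (maxn N M), (fun n => trunc N c n + trunc M d n).
rewrite (_ : (fun x => _) = fun x => (f x - \sum_(1 <= n < N.+1) c n * dilate phi n x) +
   (g x - \sum_(1 <= n < M.+1) d n * dilate phi n x)).
  by apply: cqnormD_lt => //; exact: cmeasurableB.
apply/funext => x; rewrite (wide N (maxn N M)) ?leq_maxl // (wide M (maxn N M)) ?leq_maxr //.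
rewrite addrACA -opprD -big_split /=; congr (_ - _).
by apply: eq_bigr => n _; rewrite mulrDl.
Qed.

Lemma spanned0 : spanned (fun=> 0).
Proof.
move=> e e0; exists 0%N, (fun=> 0).
rewrite /cqnorm integral0_eq ?lte_fin // => x _.
by rewrite big_geq // subr0 sqn0.
Qed.

Lemma spanned_sum (I : Type) (r : seq I) (F : I -> R -> R[i]) :
  (forall i, cmeasurable I01 (F i)) -> (forall i, spanned (F i)) ->
  spanned (fun x => \sum_(i <- r) F i x).
Proof.
move=> mF FS; elim: r => [|i r IH].
  by rewrite (_ : (fun x => _) = fun=> 0); [exact: spanned0|apply/funext => x; rewrite big_nil].
rewrite (_ : (fun x => _) = fun x => F i x + \sum_(j <- r) F j x).
  by apply: spannedD => //; exact: cmeasurable_sum.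
by apply/funext => x; rewrite big_cons.
Qed.

Lemma spanned_lim f : cmeasurable I01 f ->
  (forall e, 0 < e -> exists g, [/\ cmeasurable I01 g, spanned g &
     (cqnorm (fun x => f x - g x)%R < e%:E)%E]) -> spanned f.
Proof.
move=> ff H e e0; have e4 : 0 < e / 4 by rewrite divr_gt0.
have [g [gg /(_ _ e4)[N [c gc]] fg]] := H _ e4; exists N, c.
rewrite (_ : (fun x => _) = fun x => (f x - g x) +
    (g x - \sum_(1 <= n < N.+1) c n * dilate phi n x)).
  by apply: cqnormD_lt => //; exact: cmeasurableB.
by apply/funext => x; rewrite addrA subrK.
Qed.

Lemma complete_dilates : (forall n, (0 < n)%N -> spanned (csine n)) ->
  complete_system (dilate phi).
Proof.
move=> sineS.
have sineS0 n : spanned (csine n).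
  case: n => [|n]; last exact: sineS.
  rewrite (_ : csine 0%N = fun=> 0); first exact: spanned0.
  by apply/funext => x; rewrite /csine /sine !mul0r sin0 mulr0.
have realS (f : R -> R) : sq_integrable f -> spanned (fun x => (f x)%:C).
  move=> [ff f2]; apply: spanned_lim; first exact: cmeasurable_real.
  move=> e e0; have [P [[N [c PE]] fP]] := sine_polys_dense ff f2 e0.
  exists (fun x => \sum_(1 <= n < N.+1) (c n)%:C * csine n x); split.
  - exact: (cmeasurable_sum_csine (fun n => (c n)%:C)).
  - apply: spanned_sum => n; first by apply: cmeasurableZ; exact: cmeasurable_csine.
    by apply: spannedZ => //; exact: cmeasurable_csine.
  rewrite (_ : (fun x => _) = fun x => (f x - P x)%:C) ?cqnorm_real //.
  apply/funext => x; rewrite rmorphB PE rmorph_sum; congr (_ - _).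
  by apply: eq_bigr => n _; rewrite rmorphM.
move=> g /in_L2_cqnorm[mg g2] e e0; have [m1 m2] := mg.
rewrite cqnorm_ReIm // in g2.
have gS : spanned g.
  rewrite (_ : g = fun x => (complex.Re (g x))%:C + 'i%C * (complex.Im (g x))%:C); last first.
    by apply/funext => x; case: (g x) => p q; simpc.
  apply: spannedD.
  - exact: cmeasurable_real.
  - by apply: cmeasurableZ; exact: cmeasurable_real.
  - apply: realS; split => //; apply: le_lt_trans g2; rewrite leeDl // qnorm_ge0 //.
  apply: spannedZ; first exact: cmeasurable_real.
  apply: realS; split => //; apply: le_lt_trans g2; rewrite leeDr // qnorm_ge0 //.
have [|N [c H]] := gS (e ^+ 2); first by rewrite exprn_gt0.
by exists N, c; exact: L2_norm_lt.
Qed.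

End Spanned.

Section Dilates.
Context {R : realType}.
Local Notation mu := (@lebesgue_measure R).
Local Notation I01 := (`]0%R, 1%R[%classic : set R).
Implicit Types (psi : R -> R[i]).

Lemma cmeasurable_odd_periodic psi : cmeasurable I01 psi ->
  (forall x, psi (- x) = - psi x) -> (forall x, psi (x + 2) = psi x) ->
  cmeasurable [set: R]%classic psi.
Proof.
move=> [m1 m2] psi_odd psi_per; split; apply: measurable_odd_periodic => // x.
- by rewrite psi_odd raddfN.
- by rewrite psi_per.
- by rewrite psi_odd raddfN.
- by rewrite psi_per.
Qed.

Lemma cmeasurable_dilate psi n D : cmeasurable [set: R]%classic psi ->
  cmeasurable D (dilate psi n).
Proof.
move=> [m1 m2]; have mn : measurable_fun D (fun x : R => n%:R * x) by exact: measurable_funM.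
split; [exact: (measurableT_comp m1 mn)|exact: (measurableT_comp m2 mn)].
Qed.

(** The squared modulus of psi is even and of period 2. *)
Lemma cqnorm_dilate psi n : (0 < n)%N -> cmeasurable [set: R]%classic psi ->
  (forall x, psi (- x) = - psi x) -> (forall x, psi (x + 2) = psi x) ->
  cqnorm (dilate psi n) = cqnorm psi.
Proof.
move=> n0 mpsi psi_odd psi_per.
apply: (@ge0_integral_dilate R n (fun x => (sqn (psi x))%:E)) => //.
- exact: measurable_sqn.
- by move=> x; rewrite lee_fin sqn_ge0.
- by move=> x; rewrite psi_odd sqnN.
- by move=> x; rewrite psi_per.
Qed.

Lemma csine_odd n (x : R) : csine n (- x) = - csine n x.
Proof. by rewrite /csine /sine mulrN sinN mulrN rmorphN. Qed.

Lemma csine_periodic n (x : R) : csine n (x + 2) = csine n x.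
Proof.
have sin_per (y : R) : sin (y + pi *+ 2 *+ n) = sin y.
  by elim: n => [|n IH]; rewrite ?mulr0n ?addr0 // mulrSr addrA sinD2pi.
have -> : csine n (x + 2) = (Num.sqrt 2 * sin (n%:R * pi * x + pi *+ 2 *+ n))%:C.
  rewrite /csine /sine mulrDr; congr (_ * sin (_ + _))%:C.
  by rewrite -(mulr_natr (_ *+ _) n) -(mulr_natr pi 2); ring.
by rewrite sin_per.
Qed.

Lemma csine_dilate n k (x : R) : csine n (k%:R * x) = csine (k * n) x.
Proof. by rewrite /csine /sine natrM; congr (_ * sin _)%:C; ring. Qed.

End Dilates.

Section Approximation.
Context {R : realType}.
Local Notation I01 := (`]0%R, 1%R[%classic : set R).
Variables (phi : R -> R[i]) (a : nat -> R[i]).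
Hypothesis phi_meas : cmeasurable I01 phi.
Hypothesis phi_fin : (cqnorm phi < +oo)%E.
Hypothesis phi_odd : forall x, phi (- x) = - phi x.
Hypothesis phi_per : forall x, phi (x + 2) = phi x.
Hypothesis a_coef : forall n : nat, (0 < n)%N -> a n = sine_coef phi n.

Let mphi : cmeasurable [set: R]%classic phi.
Proof. exact: cmeasurable_odd_periodic. Qed.

Let partial L (x : R) := \sum_(1 <= l < L.+1) sine_coef phi l * csine l x.

(** In the basis of the sines, sum p_n phi_n has the coefficients p * a; so
    the first sine is as close to the span of the dilates as 1 is to the
    multiples of the Dirichlet series of a. *)
Lemma near_first_sine (e : R) : l2 a -> near_invertible a -> 0 < e ->
  exists M p, (cqnorm (fun x => (csine 1%N x - \sum_(1 <= n < M.+1) p n * dilate phi n x)%R) < e%:E)%E.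
Proof.
move=> al2 ainv e0.
have e32 : 0 < e / 32 by rewrite divr_gt0.
have [M [p [p0 Hp]]] := ainv _ e32.
exists M, p.
pose S : R := \sum_(1 <= n < M.+1) sqn (p n).
have S0 : 0 <= S by apply: sumr_ge0 => *; exact: sqn_ge0.
pose C : R := M%:R * S + 1.
have C0 : 0 < C by rewrite ltr_wpDl // mulr_ge0.
have eC : 0 < e / (32 * C) by rewrite divr_gt0 // mulr_gt0.
have [L1 HL1] := l2_tail al2 eC.
have [L2 HL2] := cfourier_converges phi_meas phi_fin eC.
pose L := maxn L1 L2; pose T := (M * L + M).+1.
have tail N : nsq N (fun n => a n - trunc L a n) <= e / (32 * C).
  apply: le_trans (HL1 N); apply: ler_sum_nat => n _.
  rewrite /trunc; have [nL1|L1n] := leqP n L1.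
    by rewrite (leq_trans nL1) ?leq_maxl // subrr sqn0 sqn_ge0.
  by case: ifP; rewrite ?subr0 // subrr sqn0 sqn_ge0.
have m_partial D : cmeasurable D (partial L) by exact: cmeasurable_sum_csine.
pose res x := phi x - partial L x.
have m_res : cmeasurable [set: R]%classic res by exact: cmeasurableB.
have res_odd x : res (- x) = - res x.
  rewrite /res.
  have -> : partial L (- x) = - partial L x.
    by rewrite /partial -sumrN; apply: eq_bigr => l _; rewrite csine_odd mulrN.
  by rewrite phi_odd opprB addrC opprK.
have res_per x : res (x + 2) = res x.
  by rewrite /res /partial phi_per; under eq_bigr do rewrite csine_periodic.
(* for the partial sums of phi, the combination of dilates is the sine
   polynomial with coefficients p * (truncation of a) *)
have dil_partial (x : R) : \sum_(1 <= n < M.+1) p n * partial L (n%:R * x) =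
    \sum_(1 <= m < T.+1) dconv p (trunc L a) m * csine m x.
  rewrite (@sum_dconv_supp _ _ _ (fun m => csine m x) M L) //; last 3 first.
  - by move=> n; exact: trunc_supp.
  - by rewrite /T leqW // leq_addr.
  - by rewrite /T leqW // leq_addl.
  apply: eq_bigr => n _; rewrite /partial mulr_sumr; apply: eq_big_nat => l /andP[l0 lL].
  by rewrite csine_dilate /trunc -ltnS lL a_coef // mulrA.
rewrite (_ : (fun x => _) = fun x =>
    (\sum_(1 <= m < T.+1) (delta1 m - dconv p (trunc L a) m) * csine m x) +
    (-1) * (\sum_(1 <= n < M.+1) p n * dilate res n x)); last first.
  apply/funext => x.
  have -> : \sum_(1 <= n < M.+1) p n * dilate phi n x =
      \sum_(1 <= n < M.+1) p n * partial L (n%:R * x) +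
      \sum_(1 <= n < M.+1) p n * dilate res n x.
    rewrite -big_split; apply: eq_bigr => n _ /=.
    by rewrite -mulrDr /dilate /res addrC subrK.
  rewrite dil_partial mulN1r opprD addrA; congr (_ - _).
  under [in RHS]eq_bigr do rewrite mulrBl.
  rewrite sumrB; congr (_ - _).
  rewrite (big_nat_recl T) //= /delta1 eqxx mul1r big_nat big1 ?addr0 // => n /andP[n0 _].
  by rewrite eqSS gtn_eqF // mul0r.
have m_dil n : cmeasurable I01 (dilate res n) by exact: cmeasurable_dilate.
apply: cqnormD_lt.
- exact: cmeasurable_sum_csine.
- by apply: cmeasurableZ; apply: cmeasurable_sum => n; exact: cmeasurableZ.
- rewrite cqnorm_sum_csine lte_fin.
  have -> : nsq T (fun m => delta1 m - dconv p (trunc L a) m) =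
     nsq T (fun m => - (dconv p a m - delta1 m) + dconv (fun n => a n - trunc L a n) p m).
    apply: eq_nsq => m /andP[m0 _]; rewrite (dconvC (fun n => a n - trunc L a n) p) // dconvBr; ring.
  apply: (le_lt_trans (nsqD_le _ _ _)); rewrite nsqN.
  have H1 := Hp T.
  have H2 : nsq T (dconv (fun n => a n - trunc L a n) p) <= e / 32.
    apply: (le_trans (nsq_dconv_supp _ _ p0)).
    apply: (@le_trans _ _ (C * (e / (32 * C)))).
      by apply: ler_pM => //; rewrite ?mulr_ge0 ?nsq_ge0 // lerDl.
    rewrite le_eqVlt; apply/orP; left; apply/eqP; field; by rewrite gt_eqF.
  lra.
rewrite cqnormZ; last by apply: cmeasurable_sum => n; exact: cmeasurableZ.
rewrite sqnN sqn1 mul1e.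
apply: (le_lt_trans (cqnorm_sum_le _ _)); first by move=> n; exact: cmeasurableZ.
have -> : (\sum_(i <- index_iota 1 M.+1) cqnorm (fun x : R => (p i * dilate res i x)%R) =
    S%:E * cqnorm res)%E.
  rewrite /S -sumEFin ge0_sume_distrl; last by move=> i _; rewrite lee_fin sqn_ge0.
  by apply: eq_big_nat => n /andP[n0 _]; rewrite cqnormZ // cqnorm_dilate.
have res_lt := HL2 L (leq_maxr _ _).
rewrite size_iota subn1 /= muleA -EFinM.
apply: (@le_lt_trans _ _ ((M%:R * S)%:E * (e / (32 * C))%:E)%E).
  by rewrite lee_wpmul2l ?lee_fin ?mulr_ge0 // ltW.
rewrite -EFinM lte_fin; apply: (@le_lt_trans _ _ (C * (e / (32 * C)))).
  by rewrite ler_wpM2r ?(ltW eC) // lerDl.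
rewrite (_ : C * _ = e / 32); last by field; rewrite gt_eqF.
lra.
Qed.

(** Dilate by k an approximation of the first sine. *)
Lemma spanned_csine k : l2 a -> near_invertible a -> (0 < k)%N -> spanned phi (csine k).
Proof.
move=> al2 ainv k0 e e0; have [M [p H]] := near_first_sine al2 ainv e0.
exists (k * M)%N, (spread k p).
pose psi x := csine 1%N x - \sum_(1 <= n < M.+1) p n * dilate phi n x.
rewrite (_ : (fun x => _) = dilate psi k).
  rewrite cqnorm_dilate //.
  - apply: cmeasurableB; first exact: cmeasurable_csine.
    by apply: cmeasurable_sum => n; apply: cmeasurableZ; exact: cmeasurable_dilate.
  - move=> x; rewrite /psi csine_odd.
    have -> : \sum_(1 <= n < M.+1) p n * dilate phi n (- x) =
        - \sum_(1 <= n < M.+1) p n * dilate phi n x.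
      rewrite -sumrN; apply: eq_bigr => n _.
      by rewrite /dilate mulrN phi_odd mulrN.
    by rewrite opprB addrC opprK.
  - move=> x; rewrite /psi csine_periodic; congr (_ - _); apply: eq_bigr => n _.
    rewrite /dilate mulrDr -[n%:R * 2]mulrC -natrM; congr (_ * _).
    exact: periodic_nat.
apply/funext => x; rewrite /dilate /psi csine_dilate muln1; congr (_ - _).
rewrite (eq_bigr (fun n => if (k %| n)%N then p (n %/ k)%N * phi (n%:R * x) else 0)); last first.
  by move=> n _; rewrite /spread; case: ifP => // _; rewrite mul0r.
rewrite -big_mkcond sum_multiples // mulKn //; apply: eq_bigr => n _.
by rewrite mulKn // natrM; congr (_ * phi _); ring.
Qed.

End Approximation.

Local Close Scope classical_set_scope.

Theorem theorem5p7 (R : realType) (phi : R -> R[i]) (a b : nat -> R[i])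
  (phi_L2 : in_L2 phi)
  (phi_odd : forall x : R, phi (- x) = - phi x)
  (phi_periodic : forall x : R, phi (x + 2) = phi x)
  (a_coef : forall n : nat, (0 < n)%N -> a n = sine_coef phi n)
  (a1 : a 1%N = 1)
  (b_reciprocal : is_reciprocal a b)
  (abc : [\/ series_in_Hd a /\ series_in_Hd b,
             series_in_M a /\ series_in_H b |
             series_in_H a /\ series_in_M b]) :
  complete_system (dilate phi).
Proof.
have [phi_meas phi_fin] := in_L2_cqnorm phi_L2.
have [al2 ainv] := l2_near_invertible a1 b_reciprocal abc.
apply: complete_dilates => n.
  by apply: cmeasurable_dilate; exact: cmeasurable_odd_periodic.
by move=> n0; apply: (spanned_csine phi_meas phi_fin phi_odd phi_periodic a_coef).
Qed.
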